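(* Let $k$ be a nonnegative integer, let $M$ be a $3$-connected matroid, let $\mathcal{T}$ be a tangle of $M$, let $N$ be a minor of $M$ with no loops and no coloops, and let $t := \rank_{\mathcal{T}}(E(N))$. If the order of $\mathcal{T}$ is at least $20k + t - 13$, then there is a set $X \subseteq E(M)$ with $|X|=k$ such that $\rank_{\mathcal{T}}(E(N)\cup X) = t + k$, and such that one of $M\setminus X$ and $M/X$ is $3$-connected with $N$ as a minor.
   Context: The connectivity function of a matroid $M$ is $\lambda_M(X) = \rank_M(X) + \rank_M(E(M)\setminus X) - \rank(M)$ for $X\subseteq E(M)$. A tangle of order $\theta$ of $M$ is a collection $\mathcal{T}$ of subsets of $E(M)$ such that: (i) $\lambda_M(X)<\theta$ for all $X\in\mathcal{T}$; (ii) for every $X\subseteq E(M)$ with $\lambda_M(X)<\theta$, either $X\in\mathcal{T}$ or $E(M)\setminus X\in\mathcal{T}$; (iii) if $X,Y,Z\in\mathcal{T}$ then $X\cup Y\cup Z\neq E(M)$; (iv) $E(M)\setminus\{e\}\notin\mathcal{T}$ for every $e\in E(M)$. The tangle matroid $M(\mathcal{T})$ is the matroid on $E(M)$ whose rank function $\rank_{\mathcal{T}}$ is given by $\rank_{\mathcal{T}}(X) = \min\{\lambda_M(Y): X\subseteq Y\in\mathcal{T}\}$ if some member of $\mathcal{T}$ contains $X$, and $\rank_{\mathcal{T}}(X)=\theta$ otherwise (this is a matroid rank function). ''$M'$ has $N$ as a minor'' means $N$ itself (with labelled ground set) equals $M'/C\setminus D$ for some disjoint $C,D\subseteq E(M')$.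 *)

(* Defs.v *)
From mathcomp Require Import all_boot.
Set Implicit Arguments. Unset Strict Implicit. Unset Printing Implicit Defensive.

Record matroid (T : finType) := Matroid { ground : {set T}; rk : {set T} -> nat }.

Section Matroids.
Variable T : finType.
Implicit Types (M N : matroid T) (X Y Z C D : {set T}).

Definition is_matroid M : Prop :=
  [/\ forall X, X \subset ground M -> rk M X <= #|X|,
      forall X Y, X \subset Y -> Y \subset ground M -> rk M X <= rk M Y &
      forall X Y, X \subset ground M -> Y \subset ground M ->
        rk M (X :|: Y) + rk M (X :&: Y) <= rk M X + rk M Y].

Definition delete M D : matroid T := Matroid (ground M :\: D) (rk M).
Definition contract M C : matroid T :=
  Matroid (ground M :\: C) (fun X => rk M (X :|: C) - rk M C).

Definition matroid_eq M N : Prop :=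
  ground M = ground N /\ forall X, X \subset ground M -> rk M X = rk N X.

Definition has_minor M N : Prop :=
  exists C D, [/\ C \subset ground M, D \subset ground M, [disjoint C & D] &
                  matroid_eq N (delete (contract M C) D)].

Definition lambda M X : nat :=
  rk M X + rk M (ground M :\: X) - rk M (ground M).

Definition separation M (k : nat) X : Prop :=
  [/\ X \subset ground M, k <= #|X|, k <= #|ground M :\: X| & lambda M X < k].

Definition three_connected M : Prop :=
  forall k, 1 <= k < 3 -> forall X, ~ separation M k X.

Definition is_loop M (e : T) : Prop := e \in ground M /\ rk M [set e] = 0.
Definition is_coloop M (e : T) : Prop :=
  e \in ground M /\ rk M (ground M :\ e) < rk M (ground M).

Definition no_loops M : Prop := forall e, ~ is_loop M e.
Definition no_coloops M : Prop := forall e, ~ is_coloop M e.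

Definition is_tangle M (theta : nat) (Tg : {set {set T}}) : Prop :=
  [/\ forall X, X \in Tg -> X \subset ground M /\ lambda M X < theta,
      forall X, X \subset ground M -> lambda M X < theta ->
        X \in Tg \/ (ground M :\: X) \in Tg,
      forall X Y Z, X \in Tg -> Y \in Tg -> Z \in Tg ->
        X :|: Y :|: Z <> ground M &
      forall e, e \in ground M -> (ground M :\ e) \notin Tg].

Definition tangle_rank M (theta : nat) (Tg : {set {set T}}) X : nat :=
  if [exists Y in Tg, X \subset Y]
  then \big[minn/theta]_(Y in Tg | X \subset Y) lambda M Y
  else theta.

End Matroids.

(* Main.v *)
Require Import Defs.
From mathcomp Require Import all_boot.
From mathcomp Require Import order zify.

Set Implicit Arguments.
Unset Strict Implicit.
Unset Printing Implicit Defensive.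

(* Let [F] be the ground set of [N].

   One element. Let [P] be a proper subset, closed in the tangle matroid and
   containing [F]. If deleting [x] destroys 3-connectivity, then [x] lies in
   the coclosure of a small 3-separating set, which obstructs the deletion;
   dually for contraction. A small set not contained in [P] meets [P] in at
   most one element, so [N] restricts the choice between deletion and
   contraction very little. If no element outside [P] could be removed,
   uncrossing would bring a minimal obstruction down to two or three
   elements, where Tutte's triangle lemma produces a fan; but an end of a
   maximal fan that avoids [P] can be removed.

   Many elements. Iterating [10 k - 6] times gives disjoint sets [D]
   (deleted) and [G] (contracted) such that [D :|: G] is independent over [F]
   in the tangle matroid and [M \ D / G] is 3-connected with [N] as a minor;
   each step costs two units of the order of the tangle. For [K] contained in
   [D], only a series pair [{z, w}] of [M \ D] with [z] in [G] can prevent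
   [M \ K] from being 3-connected, and it does so only if [K] contains every
   element of [D] that breaks the pair; dually in [G]. By orthogonality the
   conflicts between [z] and [d] are the same on both sides, and every series
   pair has a conflict with an element removed later than [z]. Following such
   later partners gives a forest on [D :|: G]. Its leaves, and its non-leaves
   without leaf children on two consecutive levels out of every four, can be
   restored freely; one of these sets has [k] elements in [D] or [k] in [G]. *)

Ltac rewrite_membership :=
  repeat match goal with
  | H : is_true (~~ ?b) |- context [?b] => rewrite (negbTE H)
  | H : is_true (~~ (?x == ?y)) |- context [?y == ?x] =>
      rewrite (eq_sym y x) (negbTE H)
  | H : is_true (?x \in ?A) |- context [?x \in ?A] => rewrite H
  end.

Ltac case_membership :=
  rewrite_membership; rewrite ?eqxx /=;
  repeat match goal with
  | |- context [?x \in ?A] => case: (x \in A) => /=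
  | |- context [?x == ?y] => case: (x == y) => /=
  end.

Ltac solve_membership u :=
  repeat match goal with
  | H : is_true (_ \subset _) |- _ => move: (introT implyP (subsetP H u));
    clear H
  end;
  rewrite ?inE; rewrite_membership;
  repeat match goal with
  | |- context [u == ?x] => case: (eqVneq u x) => [?|?]; [subst u|]
  end;
  case_membership; try by [].

Ltac clear_inclusions :=
  repeat match goal with H : is_true (_ \subset _) |- _ => clear H end.

(* Decides a Boolean identity, inclusion or membership between finite sets
   point by point, first without and then with the inclusions in the context. *)
Ltac set_solve :=
  let at_point u :=
    first [solve [clear_inclusions; solve_membership u] | solve_membership u] in
  match goal with
  | |- @eq _ _ _ => let u := fresh "u" in apply/setP=> u; at_point u
  | |- is_true (_ \subset _) => let u := fresh "u" in apply/subsetP=> u;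
    at_point u
  | |- is_true (?u \in _) => at_point u
  | |- is_true (~~ (?u \in _)) => at_point u
  end.

(* [lia] preprocesses every hypothesis; those about sets only slow it down. *)
Ltac rank_lia :=
  intros;
  repeat match goal with H := _ |- _ => clearbody H end;
  repeat match goal with
  | H : is_true (~~ _) |- _ => clear H
  | H : is_true (_ \in _) |- _ => clear H
  | H : is_true (_ \subset _) |- _ => clear H
  | H : @eq (set_of _) _ _ |- _ => clear H
  | H : @eq bool _ _ |- _ => clear H
  end; lia.

(** * Rank functions and duality *)

Section SmallSets.
Variable T : finType.
Implicit Types (x y z : T) (A : {set T}).

Lemma cards3 x y z : x != y -> x != z -> y != z -> #|[set x; y; z]| = 3.
Proof.
move=> xy xz yz; rewrite setUC cardsU1 cards2 xy !inE.
by rewrite (eq_sym z x) (eq_sym z y) (negbTE xz) (negbTE yz).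
Qed.

Lemma cards2_mem A y : #|A| = 2 -> y \in A ->
  exists2 w, w != y & A = [set y; w].
Proof.
move=> cA yA; have /cards1P[w e] : #|A :\ y| == 1.
  by have := cardsD1 y A; rewrite yA; lia.
have : w \in A :\ y by rewrite e set11.
by rewrite !inE => /andP[wy _]; exists w => //; rewrite -(setD1K yA) e.
Qed.

Lemma cards3_mem A x : #|A| = 3 -> x \in A ->
  exists y z, [/\ x != y, x != z, y != z & A = [set x; y; z]].
Proof.
move=> cA xA; have /cards2P[y [z [yz e]]] : #|A :\ x| == 2.
  by have := cardsD1 x A; rewrite xA; lia.
have [yAx zAx] : y \in A :\ x /\ z \in A :\ x by rewrite e !inE !eqxx orbT.
move: yAx zAx; rewrite !inE => /andP[yx _] /andP[zx _].
by exists y, z; split; rewrite // 1?eq_sym // -(setD1K xA) e setUA.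
Qed.

Lemma card_setU_disjoint A B : A :&: B = set0 -> #|A :|: B| = #|A| + #|B|.
Proof. by move=> e; have := cardsUI A B; rewrite e cards0 addn0. Qed.

Lemma subset_of_card A k : k <= #|A| ->
  exists2 K : {set T}, K \subset A & #|K| = k.
Proof.
case/card_geqP=> l [ul sl lA]; exists [set:: l].
  by apply/subsetP=> x; rewrite inE; apply: lA.
by rewrite cardsE (card_uniqP ul).
Qed.

End SmallSets.

Section RankFunctions.
Variable T : finType.
Implicit Types (x y z w : T) (A B C D V X Y Z : {set T})
  (r s lam : {set T} -> nat).

Record rank_function r : Prop := {
  rank_le_card : forall X, r X <= #|X|;
  rank_mono : forall X Y, X \subset Y -> r X <= r Y;
  rank_submod : forall X Y, r (X :|: Y) + r (X :&: Y) <= r X + r Y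
}.

(* [r] is a rank function, [s] its dual and [lam] their connectivity function;
   the conditions are symmetric in [r] and [s]. *)
Record dual_ranks lam r s : Prop := {
  primal_rank : rank_function r;
  dual_rank : rank_function s;
  rank_conn : forall X, r X + s X = #|X| + lam X;
  rank_dual : forall X, s X + r setT = #|X| + r (~: X)
}.

Lemma dual_ranksC lam r s : dual_ranks lam r s -> dual_ranks lam s r.
Proof.
case=> R S rs dl; split=> // X; first by rewrite addnC.
have r0 : r set0 = 0 by have := rank_le_card R set0; rewrite cards0; lia.
have := dl setT; have := dl (~: X); rewrite setCK setCT r0.
by have := cardsC X; rewrite cardsT; lia.
Qed.

Section OneRank.
Variable r : {set T} -> nat.
Hypothesis R : rank_function r.

Lemma rank0 : r set0 = 0.
Proof. by have := rank_le_card R set0; rewrite cards0; lia. Qed.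

Lemma rankU X Y : r (X :|: Y) <= r X + r Y.
Proof. by have := rank_submod R X Y; lia. Qed.

Lemma rankU1 x X : r X <= r (x |: X) <= r X + 1.
Proof.
have := rank_mono R (subsetUr [set x] X); have := rankU [set x] X.
by have := rank_le_card R [set x]; rewrite cards1; lia.
Qed.

Lemma rank_leT X : r X <= r setT.
Proof. exact: rank_mono (subsetT X). Qed.

Lemma rankT_le X : r setT <= r X + r (~: X).
Proof. by have := rankU X (~: X); rewrite setUCr. Qed.

Lemma rank_closureS x A B : A \subset B -> r (x |: A) = r A -> r (x |: B) = r B.
Proof.
move=> AB e; have := rank_submod R (x |: A) B; have := rankU1 x B.
have -> : (x |: A) :|: B = x |: B by set_solve.
have : r A <= r ((x |: A) :&: B) by apply: (rank_mono R); set_solve.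
by lia.
Qed.

Lemma rank_closureU V A : (forall x, x \in V -> r (x |: A) = r A) ->
  r (V :|: A) = r A.
Proof.
have [n] := ubnP #|V|; elim: n V => // n IHn V; rewrite ltnS => cV cl.
have [->|[x xV]] := set_0Vmem V; first by rewrite set0U.
have cx := cardsD1 x V; rewrite xV in cx.
rewrite -(setD1K xV) -setUA (rank_closureS (A := A)) ?subsetUr ?cl //.
by apply: IHn => [|y]; [lia | rewrite inE => /andP[_ /cl]].
Qed.

Lemma rank_eq_card A : (forall x, x \in A -> r (A :\ x) < r A) -> r A = #|A|.
Proof.
have [n] := ubnP #|A|; elim: n A => // n IHn A; rewrite ltnS => cA indep.
have [->|[y yA]] := set_0Vmem A; first by rewrite rank0 cards0.
have cy := cardsD1 y A; rewrite yA in cy.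
have := rank_le_card R A; have := indep y yA.
rewrite (IHn (A :\ y)); [lia | lia |].
move=> x; rewrite !inE => /andP[xy xA]; rewrite ltnNge; apply/negP => le_indep.
have e : r (x |: (A :\ y :\ x)) = r (A :\ y :\ x).
  have := rank_mono R (subsetUr [set x] (A :\ y :\ x)).
  have -> : x |: (A :\ y :\ x) = A :\ y by set_solve.
  by lia.
have sub : A :\ y :\ x \subset A :\ x by set_solve.
by have := rank_closureS sub e; rewrite setD1K //; have := indep x xA; lia.
Qed.

End OneRank.

Section Existence.
Variable r : {set T} -> nat.
Hypothesis R : rank_function r.

Definition corank X := #|X| + r (~: X) - r setT.
Definition connectivity X := r X + r (~: X) - r setT.

Let le_corank X : r setT <= #|X| + r (~: X).
Proof. by have := rank_le_card R X; have := rankT_le R X; lia. Qed.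

Lemma corank_rank_function : rank_function corank.
Proof.
split=> [X|X Y XY|X Y]; rewrite /corank.
- by have := rank_leT R (~: X); lia.
- have := rankU R (Y :\: X) (~: Y); have := rank_le_card R (Y :\: X).
  have := cardsID X Y; have -> : Y :&: X = X by set_solve.
  have -> : (Y :\: X) :|: ~: Y = ~: X by set_solve.
  by lia.
have := rank_submod R (~: X) (~: Y); rewrite -setCI -setCU.
have := cardsUI X Y; have := le_corank (X :|: Y); have := le_corank (X :&: Y).
by lia.
Qed.

Lemma dual_ranks_corank : dual_ranks connectivity r corank.
Proof.
split=> [//||X|X]; first exact: corank_rank_function.
  by have := le_corank X; have := rankT_le R X;
    rewrite /connectivity /corank; lia.
by have := le_corank X; rewrite /corank; lia.
Qed.

End Existence.

Section Duality.
Variables lam r s : {set T} -> nat.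
Hypothesis M : dual_ranks lam r s.
Let R := primal_rank M.
Let S := dual_rank M.

Lemma connE X : lam X + r setT = r X + r (~: X).
Proof. by have := rank_conn M X; have := rank_dual M X; lia. Qed.

Lemma conn_setC X : lam (~: X) = lam X.
Proof. by have := connE X; have := connE (~: X); rewrite setCK; lia. Qed.

Lemma conn_submod X Y : lam (X :|: Y) + lam (X :&: Y) <= lam X + lam Y.
Proof.
have := rank_submod R X Y; have := rank_submod S X Y; have := cardsUI X Y.
have := rank_conn M X; have := rank_conn M Y.
by have := rank_conn M (X :|: Y); have := rank_conn M (X :&: Y); lia.
Qed.

Lemma conn_posimod X Y : lam (X :\: Y) + lam (Y :\: X) <= lam X + lam Y.
Proof.
have := conn_submod X (~: Y); rewrite conn_setC -setDE.
have -> : X :|: ~: Y = ~: (Y :\: X) by set_solve.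
by rewrite conn_setC; lia.
Qed.

Lemma conn_le_card X : lam X <= #|X|.
Proof.
by have := rank_conn M X; have := rank_le_card R X;
  have := rank_le_card S X; lia.
Qed.

Lemma connU_le X Y : lam (X :|: Y) <= lam X + #|Y|.
Proof. by have := conn_submod X Y; have := conn_le_card Y; lia. Qed.

Lemma rankU1_coclosure x V Z : x \notin Z -> V \subset ~: (x |: Z) ->
  s (x |: V) = s V -> r (x |: Z) = r Z + 1.
Proof.
move=> xZ VZ e; have := rank_closureS S VZ e.
have -> : x |: ~: (x |: Z) = ~: Z by set_solve.
have := rank_dual M (~: Z); have := rank_dual M (~: (x |: Z)); rewrite !setCK.
have := cardsC Z; have := cardsC (x |: Z); rewrite cardsU1 xZ.
by lia.
Qed.

Lemma connU1_coclosure x V Z : x \notin Z -> V \subset ~: (x |: Z) ->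
  s (x |: V) = s V -> lam Z <= lam (x |: Z).
Proof.
move=> xZ VZ e; have := rankU1_coclosure xZ VZ e; have := rankU1 S x Z.
have := rank_conn M Z; have := rank_conn M (x |: Z).
by rewrite cardsU1 xZ; lia.
Qed.

Definition connected3 := forall k X, 0 < k < 3 ->
  k <= #|X| -> k <= #|~: X| -> k <= lam X.

Lemma connected3_rank X : connected3 -> #|X| <= 2 -> #|X| <= #|~: X| ->
  r X = #|X|.
Proof.
move=> c3 cX cXc; have [X0|X0] := posnP #|X|.
  by have := rank_le_card R X; lia.
have := c3 #|X| X; rewrite X0 ltnS cX => /(_ isT (leqnn _) cXc).
by have := rank_conn M X; have := rank_le_card R X;
  have := rank_le_card S X; lia.
Qed.

(* 3-connectivity of the minor obtained by deleting [D] and contracting [C]. *)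
Definition minor_connected3 (t : {set T} -> nat) D C := forall k X, 0 < k < 3 ->
  X \subset ~: (D :|: C) -> k <= #|X| -> k <= #|~: (D :|: C :|: X)| ->
  t (~: D) + t C + k <= t (X :|: C) + t (~: (D :|: X)).

Lemma minor_connected3_id : connected3 -> minor_connected3 r set0 set0.
Proof.
move=> c3 k X k3 _; rewrite !set0U setU0 setC0 (rank0 R) => cX cXc.
by have := c3 k X k3 cX cXc; have := connE X; lia.
Qed.

Lemma minor_connected3_dual D C : D \subset ~: C ->
  minor_connected3 r D C -> minor_connected3 s C D.
Proof.
move=> DC c3 k X k3; rewrite (setUC C) => XDC cX cXc;
  have := c3 k X k3 XDC cX cXc.
have := rank_dual M (~: C); have := rank_dual M D.
have := rank_dual M (X :|: D); have := rank_dual M (~: (C :|: X)).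
rewrite !setCK (setUC D) (setUC C) card_setU_disjoint;
  last by clear -XDC; set_solve.
have : #|~: C| = #|~: (X :|: C)| + #|X|.
  by rewrite -card_setU_disjoint; [congr #|pred_of_set _|; clear -XDC |];
    set_solve.
by lia.
Qed.

End Duality.

Definition simple_rank r := forall X, #|X| <= 2 -> r X = #|X|.

Definition triangle r x y z :=
  [/\ x != y, x != z, y != z & r [set x; y; z] <= 2].

Lemma triangle_perms r x y z : triangle r x y z ->
  [/\ triangle r x z y, triangle r y x z, triangle r y z x,
      triangle r z x y & triangle r z y x].
Proof.
case=> xy xz yz h; split; split; rewrite // 1?eq_sym //.
- by have -> : [set x; z; y] = [set x; y; z] by set_solve.
- by have -> : [set y; x; z] = [set x; y; z] by set_solve.
- by have -> : [set y; z; x] = [set x; y; z] by set_solve.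
- by have -> : [set z; x; y] = [set x; y; z] by set_solve.
- by have -> : [set z; y; x] = [set x; y; z] by set_solve.
Qed.

Lemma triangle_closure r x y z A : rank_function r -> simple_rank r ->
  triangle r x y z -> y \in A -> z \in A -> r (x |: A) = r A.
Proof.
move=> R simple [_ _ yz h] yA zA; apply: (rank_closureS R (A := [set y; z])).
  by rewrite subUset !sub1set yA.
have := rank_mono R (subsetUr [set x] [set y; z]).
have -> : x |: [set y; z] = [set x; y; z] by set_solve.
by rewrite simple cards2 yz //; lia.
Qed.

End RankFunctions.

Ltac permute_triangle :=
  match goal with t : triangle ?r _ _ _ |- triangle ?r _ _ _ =>
    solve [exact: t | by have [] := triangle_perms t]
  end.

(** * Removing one element of a 3-connected matroid *)

Section OneElement.
Variable T : finType.
Implicit Types (A B C D S V X Y Z : {set T}) (a b c e p q u v w x y z : T).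
Implicit Types (r s : {set T} -> nat) (del con : pred T).
Variables (lam : {set T} -> nat) (small : pred {set T}) (P F : {set T}).

(* The small sets are the members [A] of a tangle with [lam A <= 2], and [P] is
   a closed set of the tangle matroid. *)
Record small_sets : Prop := {
  conn_small : forall A, small A -> lam A <= 2;
  small_or_setC : forall A, lam A <= 2 -> small A || small (~: A);
  small_cover : forall A B C, small A -> small B -> small C ->
    A :|: B :|: C <> setT;
  small_pair : forall A, #|A| <= 2 -> small A;
  small_meet_closed : forall A x, small A -> x \in A -> x \notin P ->
    #|A :&: P| <= 1
}.

(* [del x] and [con x] stand for: the fixed minor on [F] is a minor of [M \ x],
   respectively of [M / x]. *)
Record minor_moves (r s : {set T} -> nat) (del con : pred T) : Prop := {
  del_or_con : forall x, x \notin F -> del x || con x;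
  triad_con : forall e a b, triangle s e a b -> del e -> b \notin F -> con b;
  quad_del : forall e x y z, e \notin [set x; y; z] -> triangle r x y z ->
    (forall u, u \in [set x; y; z] ->
       s ((e |: [set x; y; z]) :\ u) = s (e |: [set x; y; z])) ->
    del e -> x \notin F -> y \notin F \/ z \notin F -> del x;
  undeletable_rank : forall A, A \subset ~: F ->
    (forall x, x \in A -> ~~ del x) ->
    r A = #|A|;
  coclosure_con : forall a A, a \notin A -> A \subset ~: F ->
    s (a |: A) = s A ->
    exists2 x, x \in A & con x
}.

Record removal_context (r s : {set T} -> nat) (del con : pred T) : Prop := {
  context_ranks : dual_ranks lam r s;
  context_small : small_sets;
  context_connected3 : connected3 lam;
  context_moves : minor_moves r s del con;
  context_dual_moves : minor_moves s r con del;
  context_subset : F \subset P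
}.

Lemma removal_contextC r s del con : removal_context r s del con ->
  removal_context s r con del.
Proof. by case=> /dual_ranksC. Qed.

(* [A] witnesses that [M \ x] has a 2-separation if [t] is the corank function,
   and that [M / x] has one if [t] is the rank function. *)
Definition obstructs (t : {set T} -> nat) A x :=
  [&& x \notin A, 1 < #|A|, small (x |: A), lam A <= 2 & t (x |: A) == t A].

Definition obstructed t x := [exists A, obstructs t A x].

Section ContextFacts.
Variables (r s : {set T} -> nat) (del con : pred T).
Hypothesis ctx : removal_context r s del con.
Let M := context_ranks ctx.
Let R := primal_rank M.
Let R' := dual_rank M.
Let smalls := context_small ctx.

Lemma context_notinF x : x \notin P -> x \notin F.
Proof. by apply: contra; apply: (subsetP (context_subset ctx)). Qed.

Lemma small_meet_closed_uniq S x y z : small S -> x \in S -> x \notin P ->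
  y \in S -> y \in P -> z \in S -> z \in P -> y = z.
Proof.
move=> sS xS xP yS yP zS zP.
have /card_le1_eqP := small_meet_closed smalls sS xS xP.
by apply; rewrite inE ?yS ?zS.
Qed.

Lemma smallS A B : small B -> A \subset B -> lam A <= 2 -> small A.
Proof.
move=> sB AB lA; case/orP: (small_or_setC smalls lA) => // sA.
have [] := small_cover smalls sA sB sB; set_solve.
Qed.

Lemma smallU A B : small A -> small B -> lam (A :|: B) <= 2 -> small (A :|: B).
Proof.
move=> sA sB l; case/orP: (small_or_setC smalls l) => // sC.
have [] := small_cover smalls sA sB sC; set_solve.
Qed.

Lemma card_setC_smallU A B : small A -> small B -> 2 < #|~: (A :|: B)|.
Proof.
move=> sA sB; rewrite ltnNge; apply/negP => c.
have [] := small_cover smalls sA sB (small_pair smalls c); set_solve.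
Qed.

Lemma card_setC_small A : small A -> 2 < #|~: A|.
Proof. by move=> sA; have := card_setC_smallU sA sA; rewrite setUid. Qed.

Lemma conn_ge2 A : 1 < #|A| -> 1 < #|~: A| -> 2 <= lam A.
Proof. exact: context_connected3 ctx 2 A isT. Qed.

Lemma conn_small_eq2 A : small A -> 1 < #|A| -> lam A = 2.
Proof.
move=> sA cA; have := conn_ge2 cA; have := conn_small smalls sA.
by have := card_setC_small sA; rank_lia.
Qed.

Lemma conn_smallI A B : small A -> small B -> 1 < #|A :|: B| ->
  lam (A :&: B) <= 2.
Proof.
move=> sA sB c; have := conn_submod M A B; have := conn_ge2 c.
have := conn_small smalls sA; have := conn_small smalls sB.
by have := card_setC_smallU sA sB; rank_lia.
Qed.

Lemma small_setU A B x y : small A -> small B -> x \in A :&: B ->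
  y \in A :&: B ->
  x != y -> small (A :|: B).
Proof.
move=> sA sB xI yI xy; apply: smallU => //.
have cI : 1 < #|A :&: B| by apply/card_gt1P; exists x, y.
have := conn_submod M A B; have := conn_ge2 cI.
have := conn_small smalls sA; have := conn_small smalls sB.
have := card_setC_smallU sA sB.
have : #|~: (A :|: B)| <= #|~: (A :&: B)| by apply: subset_leq_card; set_solve.
by rank_lia.
Qed.

Lemma context_simple : simple_rank r.
Proof.
move=> A cA; apply: (connected3_rank M (context_connected3 ctx)) => //.
by have := card_setC_small (small_pair smalls cA); rank_lia.
Qed.

Lemma triangle_rankU1 x y z A : triangle r x y z -> y \in A -> z \in A ->
  r (x |: A) = r A.
Proof. exact: triangle_closure R context_simple. Qed.

Lemma triangle_small x y z : triangle r x y z -> small [set x; y; z].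
Proof.
case=> xy xz yz h; apply: smallU.
- by apply: (small_pair smalls); rewrite cards2 xy.
- by apply: (small_pair smalls); rewrite cards1.
have := rank_conn M [set x; y; z]; have := rank_le_card R' [set x; y; z].
by rewrite cards3 //; rank_lia.
Qed.

Lemma obstructs_small A x : obstructs s A x -> small A.
Proof. by case/and5P=> _ _ sA lA _; apply: smallS sA (subsetUr _ _) lA. Qed.

Lemma obstructs_setC A x : obstructs s A x ->
  s (x |: ~: (x |: A)) = s (~: (x |: A)).
Proof.
move=> ob; have sm := obstructs_small ob; case/and5P: ob => xA cA sA lA /eqP e.
have cxA : #|x |: A| = #|A| + 1 by rewrite cardsU1 xA addnC.
have lA2 := conn_small_eq2 sm cA; have lxA2 : lam (x |: A) = 2.
  by apply: conn_small_eq2; rewrite ?cxA //; rank_lia.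
have -> : x |: ~: (x |: A) = ~: A by set_solve.
have := rank_conn M A; have := rank_conn M (x |: A).
have := rank_dual (dual_ranksC M) A; have := rank_dual (dual_ranksC M) (x |: A).
by rank_lia.
Qed.

Lemma obstructs_rank A x : obstructs s A x -> r (x |: A) = r A + 1.
Proof.
move=> ob; have e := obstructs_setC ob; case/and5P: ob => xA _ _ _ _.
exact: (rankU1_coclosure M xA (subxx _) e).
Qed.

Lemma obstructs_transfer A x Z : obstructs s A x -> x \notin Z -> 1 < #|Z| ->
  small (x |: Z) -> Z \subset A \/ Z \subset ~: A -> obstructs s Z x.
Proof.
move=> ob xZ cZ sZ sub; have eC := obstructs_setC ob.
have [xA _ _ _ /eqP e] := and5P ob.
have [rZ lZ] : r (x |: Z) = r Z + 1 /\ lam Z <= lam (x |: Z).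
  case: sub => sub.
    have V : ~: (x |: A) \subset ~: (x |: Z) by set_solve.
    by split; [apply: (rankU1_coclosure M _ V) |
      apply: (connU1_coclosure M _ V)].
  have V : A \subset ~: (x |: Z) by set_solve.
  by split; [apply: (rankU1_coclosure M _ V) | apply: (connU1_coclosure M _ V)].
have lxZ := conn_small smalls sZ.
have cxZ : #|x |: Z| = #|Z| + 1 by rewrite cardsU1 xZ addnC.
have smZ : small Z by apply: smallS sZ (subsetUr _ _) _; rank_lia.
have lZ2 := conn_small_eq2 smZ cZ.
rewrite /obstructs xZ cZ sZ lZ2 /=; apply/eqP.
by have := rank_conn M Z; have := rank_conn M (x |: Z); rank_lia.
Qed.

Lemma obstructs_pair_triad x y z : obstructs s [set y; z] x -> triangle s x y z.
Proof.
case/and5P; rewrite !inE negb_or cards2 => /andP[xy xz] yz _ _ /eqP e.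
have {}yz : y != z by case: eqP yz.
split=> //; have -> : [set x; y; z] = x |: [set y; z] by set_solve.
by rewrite e; have := rank_le_card R' [set y; z]; rewrite cards2 yz.
Qed.

Lemma triangle_not_triad x y z : triangle r x y z -> ~ triangle s x y z.
Proof.
move=> tr [xy xz yz h]; have sm := triangle_small tr; have [_ _ _ h'] := tr.
have := conn_small_eq2 sm; have := rank_conn M [set x; y; z].
by rewrite cards3 // => ? /(_ isT); rank_lia.
Qed.

End ContextFacts.

Lemma triad_obstructs r s del con x y z : removal_context r s del con ->
  triangle s x y z -> obstructs s [set y; z] x.
Proof.
move=> ctx td; have ctxC := removal_contextC ctx;
  have sm := triangle_small ctxC td.
have eU : x |: [set y; z] = [set x; y; z] by set_solve.
have [xy xz yz _] := td.
rewrite /obstructs !inE negb_or xy xz cards2 yz eU sm /=.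
rewrite (conn_small (context_small ctx)) ?(small_pair (context_small ctx))
    ?cards2 ?yz //.
by rewrite -eU (triangle_rankU1 ctxC td) ?inE ?eqxx ?orbT.
Qed.

Section TutteTriangle.
Variables (r s : {set T} -> nat) (del con : pred T).
Hypothesis ctx : removal_context r s del con.
Let M := context_ranks ctx.
Let R := primal_rank M.

Definition two_separation x A B :=
  [/\ x \notin A, B = ~: (x |: A), 1 < #|A|, 1 < #|B| &
    r A + r B <= r setT + 1].

Lemma two_separationC x A B : two_separation x A B -> two_separation x B A.
Proof.
case=> xA -> cA cB sep; split; rewrite // ?inE ?eqxx // 1?addnC //.
by set_solve.
Qed.

Lemma two_separation_notin x A B z : two_separation x A B -> z \in B ->
  z \notin A.
Proof. by case=> _ -> _ _ _; rewrite !inE negb_or => /andP[]. Qed.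

Lemma two_separation_of_obstructed x y : x != y -> obstructed s x ->
  exists A B, two_separation x A B /\ y \in A.
Proof.
move=> xy /existsP[A ob].
have sep : two_separation x A (~: (x |: A)).
  have rA := obstructs_rank ctx ob; case/and5P: ob => xA cA sA _ _.
  split=> //; first by have := card_setC_small ctx sA; rank_lia.
  by have := connE M (x |: A); have := conn_small (context_small ctx) sA;
    rank_lia.
case: (boolP (y \in A)) => yA; first by exists A, (~: (x |: A)).
exists (~: (x |: A)), A; split; first exact: two_separationC.
by rewrite !inE negb_or eq_sym xy.
Qed.

Lemma two_separation_pair x y w B : two_separation x [set y; w] B ->
  triangle s x y w.
Proof.
case; rewrite !inE negb_or cards2 => /andP[xy xw] -> yw _ sep.
have {}yw : y != w by case: eqP yw.
split=> //; have := rank_dual M [set x; y; w]; rewrite cards3 //.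
have -> : [set x; y; w] = x |: [set y; w] by set_solve.
by move: sep; rewrite (context_simple ctx) cards2 ?yw //; rank_lia.
Qed.

Lemma two_separation_triangle x y z A B : triangle r x y z ->
  two_separation x A B -> y \in A -> z \in B.
Proof.
move=> tr [xA eB cA cB sep] yA; have [_ xz _ _] := tr.
rewrite eB !inE negb_or eq_sym xz; apply/negP => zA.
have e := triangle_rankU1 ctx tr yA zA; have := connE M (x |: A); rewrite -eB.
by have := conn_ge2 ctx (A := x |: A); rewrite cardsU1 xA -eB; rank_lia.
Qed.

Record crossing x y z A B C D : Prop := {
  crossing_triangle : triangle r x y z;
  crossing_sepl : two_separation x A B;
  crossing_sepr : two_separation y C D;
  crossing_yA : y \in A;
  crossing_zB : z \in B;
  crossing_xC : x \in C;
  crossing_zD : z \in D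
}.

Lemma crossingC x y z A B C D : crossing x y z A B C D ->
  crossing y x z C D A B.
Proof. by case=> tr *; split=> //; permute_triangle. Qed.

Section Crossing.
Variables (x y z : T) (A B C D : {set T}).
Hypothesis cr : crossing x y z A B C D.

Let tr := crossing_triangle cr.
Let yA := crossing_yA cr.
Let zB := crossing_zB cr.
Let xC := crossing_xC cr.
Let zD := crossing_zD cr.
Let eB : B = ~: (x |: A). Proof. by case: (crossing_sepl cr). Qed.
Let eD : D = ~: (y |: C). Proof. by case: (crossing_sepr cr). Qed.
Let sepA : r A + r B <= r setT + 1. Proof. by case: (crossing_sepl cr). Qed.
Let sepC : r C + r D <= r setT + 1. Proof. by case: (crossing_sepr cr). Qed.
Let xy : x != y. Proof. by case: tr. Qed.
Let xz : x != z. Proof. by case: tr. Qed.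
Let xA : x \notin A. Proof. by case: (crossing_sepl cr). Qed.
Let yC : y \notin C. Proof. by case: (crossing_sepr cr). Qed.
Let zA : z \notin A.
Proof. exact: two_separation_notin (crossing_sepl cr) zB. Qed.

Lemma crossing_closure_x Z : y \in Z -> z \in Z -> r (x |: Z) = r Z.
Proof. exact: (triangle_rankU1 ctx). Qed.

Lemma crossing_closure_y Z : x \in Z -> z \in Z -> r (y |: Z) = r Z.
Proof. by apply: (triangle_rankU1 ctx); permute_triangle. Qed.

Lemma crossing_opposite_conn : lam (A :&: D) + lam (B :&: C) <= 2.
Proof.
have eAD : ~: (A :&: D) = y |: (B :|: C) by rewrite eB eD; clear -xC; set_solve.
have eBC : ~: (B :&: C) = x |: (A :|: D) by rewrite eB eD; clear -yA; set_solve.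
have := connE M (A :&: D); have := connE M (B :&: C); rewrite eAD eBC.
rewrite crossing_closure_y ?crossing_closure_x ?inE ?zB ?xC ?yA ?zD ?orbT //.
have := rank_submod R A D; have := rank_submod R B C.
by clear -sepA sepC; rank_lia.
Qed.

Lemma crossing_opposite_card : 1 < #|A :&: D| -> #|B :&: C| = 0.
Proof.
move=> c; have := crossing_opposite_conn.
have cAD : 1 < #|~: (A :&: D)|.
  by apply/card_gt1P; exists x, z; rewrite !inE (negbTE xA) (negbTE zA).
have cBC : 0 < #|~: (B :&: C)|.
  by apply/card_gt0P; exists y; rewrite !inE (negbTE yC) andbF.
have := conn_ge2 ctx c cAD.
have := context_connected3 ctx (k := 1) (X := B :&: C) isT.
by rank_lia.
Qed.

Lemma crossing_far_rank : 1 < #|B :&: D| -> r (A :&: C) + r (B :|: D) <= r setT.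
Proof.
move=> c; have eC : ~: (A :|: C) = B :&: D.
  by rewrite eB eD; clear -xC yA; set_solve.
have cAC : 1 < #|A :|: C|.
  by apply/card_gt1P; exists x, y; rewrite !inE yA xC orbT.
have := conn_ge2 ctx cAC; rewrite eC => /(_ c); have := connE M (A :|: C);
  rewrite eC.
have := rank_submod R A C; have := rank_submod R B D.
by clear -sepA sepC; rank_lia.
Qed.

Lemma crossing_near_card : 1 < #|A :&: C| -> #|B :&: D| <= 1.
Proof.
move=> c; rewrite leqNgt; apply/negP => /crossing_far_rank far.
have eC : ~: (A :&: C) = x |: (y |: (B :|: D)).
  by rewrite eB eD; clear -xA yC xC yA; set_solve.
have := connE M (A :&: C).
rewrite eC crossing_closure_x ?inE ?zB ?eqxx ?orbT //.
have := rankU1 R y (B :|: D).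
have : 1 < #|~: (A :&: C)|.
  by apply/card_gt1P; exists x, y; rewrite !inE (negbTE xA) (negbTE yC) andbF.
by move/(conn_ge2 ctx c); rank_lia.
Qed.

Lemma crossing_near_triad : #|A :&: C| = 1 -> 1 < #|B :&: D| ->
  exists2 w, w \notin [set x; y; z] & triangle s x y w.
Proof.
move=> /eqP/cards1P[w eI] /crossing_far_rank.
rewrite eI (context_simple ctx) ?cards1 // => far.
have : w \in A :&: C by rewrite eI set11.
rewrite inE => /andP[wA wC].
have [wx wy wz] : [/\ w != x, w != y & w != z].
  by split; [apply: contraNneq xA | apply: contraNneq yC |
    apply: contraNneq zA] => <-.
exists w; first by rewrite !inE !negb_or wx wy.
split; rewrite // 1?eq_sym //; have := rank_dual M [set x; y; w].
rewrite cards3 1?(eq_sym _ w) //.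
have -> : ~: [set x; y; w] = B :|: D.
  have -> : B :|: D = ~: ((A :&: C) :|: [set x; y]).
    by rewrite eB eD; clear -xA yC xC yA; set_solve.
  by rewrite eI; clear; set_solve.
by rank_lia.
Qed.

Lemma crossing_card_inner : #|A| = #|A :&: C| + #|A :&: D| + 1.
Proof.
have := cardsID C A; have -> : A :\: C = y |: (A :&: D).
  by rewrite eD; clear -yC yA; set_solve.
by rewrite cardsU1 eD !inE eqxx /= andbF; rank_lia.
Qed.

Lemma crossing_card_outer : #|B| = #|B :&: D| + #|B :&: C|.
Proof.
have := cardsID D B; have -> // : B :\: D = B :&: C.
by rewrite eB eD; clear -yC yA xC; set_solve.
Qed.

End Crossing.

Lemma crossing_triad x y z A B C D : crossing x y z A B C D ->
  exists2 w, w \notin [set x; y; z] & triangle s x y w \/ triangle s x z w.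
Proof.
move=> cr; have crC := crossingC cr; have [_ sA sC yA zB xC zD] := cr.
have [xA eB cA cB _] := sA; have [yC _ cC cD _] := sC.
have near := crossing_near_card cr.
have opp := crossing_opposite_card cr; have oppC := crossing_opposite_card crC.
have kA := crossing_card_inner cr; have kC := crossing_card_inner crC.
have kB := crossing_card_outer cr; have kD := crossing_card_outer crC.
rewrite (setIC C A) (setIC C B) (setIC D A) (setIC D B) in oppC kC kD.
have zA := two_separation_notin sA zB; have zC := two_separation_notin sC zD.
have : #|A| = 2 \/ #|C| = 2 \/ #|B| = 2 \/ #|A :&: C| = 1 /\ 1 < #|B :&: D|.
  by clear -near opp oppC kA kB kC kD cA cB cC cD; rank_lia.
case=> [k|[k|[k|[k kd]]]].
- have [w wy e] := cards2_mem k yA; rewrite e in sA xA zA.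
  exists w; last by left; apply: two_separation_pair sA.
  by move: zA xA; rewrite !inE !negb_or wy !(eq_sym w) =>
    /andP[_ ->] /andP[_ ->].
- have [w wx e] := cards2_mem k xC; rewrite e in sC yC zC.
  have td := two_separation_pair sC; exists w; last by left; permute_triangle.
  by move: zC yC; rewrite !inE !negb_or wx !(eq_sym w) =>
    /andP[_ ->] /andP[_ ->].
- have [w wz e] := cards2_mem k zB; have sB := two_separationC sA;
    rewrite e in sB.
  exists w; last by right; apply: two_separation_pair sB.
  have : w \in B by rewrite e !inE eqxx orbT.
  rewrite eB !inE !negb_or wz => /andP[-> wA]; rewrite andbT /=.
  by apply: contraNneq wA => ->.
have [w wN td] := crossing_near_triad cr k kd; exists w => //; by left.
Qed.

Lemma tutte_triangle x y z : triangle r x y z -> obstructed s x ->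
  obstructed s y ->
  exists2 w, w \notin [set x; y; z] & triangle s x y w \/ triangle s x z w.
Proof.
move=> tr obx oby; have [xy _ _ _] := tr;
  have tr' : triangle r y x z by permute_triangle.
have [A [B [sA yA]]] := two_separation_of_obstructed xy obx.
have [yx _ _ _] := tr'.
have [C [D [sC xC]]] := two_separation_of_obstructed yx oby.
apply: (@crossing_triad x y z A B C D); split=> //.
  exact: two_separation_triangle tr sA yA.
exact: two_separation_triangle tr' sC xC.
Qed.

End TutteTriangle.

Section Uncrossing.
Variables (r s : {set T} -> nat) (del con : pred T).
Hypothesis ctx : removal_context r s del con.
Let M := context_ranks ctx.
Let smalls := context_small ctx.

Lemma obstruction_uncrossI A A' x : small A -> x \in A -> obstructs s A' x ->
  1 < #|A :&: A'| -> obstructs s (A :&: A') x.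
Proof.
move=> sA xA ob cI; have [xA' _ sA' _ _] := and5P ob.
apply: (obstructs_transfer ctx ob) => //; last by left; apply: subsetIr.
  by rewrite inE negb_and xA' orbT.
have -> : x |: A :&: A' = A :&: (x |: A') by set_solve.
apply: (smallS ctx sA (subsetIl _ _)); apply: (conn_smallI ctx) => //.
by have := subset_leq_card (subsetIl A A');
  have := subset_leq_card (subsetUl A (x |: A')); rank_lia.
Qed.

Lemma obstruction_uncrossD A A' x : small A -> x \in A -> obstructs s A' x ->
  lam (A :\: A') <= 2 -> 2 < #|A :\: A'| -> obstructs s ((A :\: A') :\ x) x.
Proof.
move=> sA xA ob l c; have [xA' _ _ _ _] := and5P ob.
have xD : x \in A :\: A' by rewrite inE xA'.
have cx := cardsD1 x (A :\: A'); rewrite xD in cx.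
apply: (obstructs_transfer ctx ob); [by rewrite !inE eqxx | by rank_lia | |
  by right; set_solve].
by rewrite setD1K //; apply: (smallS ctx sA (subsetDl _ _) l).
Qed.

Lemma obstruction_uncross A x : small A -> x \in A -> 3 < #|A| ->
  obstructed s x ->
  (exists2 A0 : {set T}, A0 \proper A & obstructs s A0 x) \/
  (exists y z, [/\ y \in A, z \notin A & triangle s x y z]).
Proof.
move=> sA xA cA /existsP[A' ob]; have [xA' cA' _ lA' _] := and5P ob.
have cID := cardsID A' A.
have properx (A0 : {set T}) : A0 \subset A -> x \notin A0 -> A0 \proper A.
  by move=> sub xA0; apply/properP; split=> //; exists x.
case: (ltnP 1 #|A :&: A'|) => cI.
  left; exists (A :&: A'); last exact: obstruction_uncrossI.
  by apply: properx; rewrite ?subsetIl // inE negb_and xA' orbT.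
have [lD|lD] := leqP (lam (A :\: A')) 2.
  left; exists ((A :\: A') :\ x); last by apply: obstruction_uncrossD => //;
    rank_lia.
  by apply: properx; [set_solve | rewrite !inE eqxx].
right; have [y yI] : exists y, y \in A :&: A'.
  apply/set0Pn/eqP=> e.
  have eD : A :\: A' = A by apply/setDidPl; rewrite -setI_eq0 e.
  by have := conn_small smalls sA; rewrite eD in lD; rank_lia.
have cI1 : #|A :&: A'| = 1.
  by have : 0 < #|A :&: A'| by [apply/card_gt0P; exists y]; rank_lia.
have cA'2 : #|A'| = 2.
  have := cardsID A A'; rewrite setIC cI1 => cID'.
  case: (ltnP 1 #|A' :\: A|) => c; last by rank_lia.
  have cDC : 1 < #|~: (A' :\: A)|.
    by apply: (@leq_trans #|A|); [rank_lia | apply: subset_leq_card; set_solve].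
  by have := conn_posimod M A A'; have := conn_ge2 ctx c cDC;
     have := conn_small smalls sA; rank_lia.
move: yI; rewrite inE => /andP[yA yA'].
have [z zy eA'] := cards2_mem cA'2 yA'.
exists y, z; split=> //; last by apply: (obstructs_pair_triad ctx);
  rewrite -eA'.
apply/negP=> zA; have : [set y; z] \subset A :&: A'.
  by rewrite subsetI -eA' subxx andbT eA' subUset !sub1set yA.
by move/subset_leq_card; rewrite cards2 eq_sym zy cI1.
Qed.

End Uncrossing.

Record stuck (r s : {set T} -> nat) (del con : pred T) : Prop := {
  stuck_context : removal_context r s del con;
  del_obstructed : forall x, x \notin P -> del x -> obstructed s x;
  con_obstructed : forall x, x \notin P -> con x -> obstructed r x
}.

Lemma stuckC r s del con : stuck r s del con -> stuck s r con del.
Proof. by case=> ctx dob cob; split=> //; apply: removal_contextC. Qed.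

(* [S] contains a fan ending in the triangle [{p, q, w}], with [w] last. *)
Definition fan_end (r s : {set T} -> nat) (del : pred T) S p q w :=
  [/\ [/\ p \in S, q \in S & w \in S], triangle r p q w,
      small S /\ lam (S :\ w) <= 2 & [/\ obstructed s q, w \notin P & del w]].

Lemma fan_end_setU1 r s del S p q w u : u \notin S -> small (u |: S) ->
  lam (u |: (S :\ w)) <= 2 -> fan_end r s del S p q w ->
    fan_end r s del (u |: S) p q w.
Proof.
move=> uS sU lU [[pS qS wS] tr _ rest].
have uw : u != w by apply: contraNneq uS => ->.
have e : (u |: S) :\ w = u |: (S :\ w) by clear -uw; set_solve.
by split=> //; rewrite ?e // !inE pS qS wS !orbT.
Qed.

Section Fans.
Variables (r s : {set T} -> nat) (del con : pred T).
Hypothesis st : stuck r s del con.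
Let ctx := stuck_context st.
Let ctxC := removal_contextC ctx.
Let M := context_ranks ctx.
Let smalls := context_small ctx.
Let moves := context_moves ctx.

Lemma conn_setU1_triad S u z w : z \in S -> w \in S -> u \notin S ->
  triangle s u z w -> lam (u |: S) <= lam S.
Proof.
move=> zS wS uS td; have := triangle_rankU1 ctxC td zS wS.
have := rankU1 (primal_rank M) u S; have := rank_conn M S.
by have := rank_conn M (u |: S); rewrite cardsU1 uS; rank_lia.
Qed.

Lemma small_setU1_triad S u z w : small S -> z \in S -> w \in S -> u \notin S ->
  triangle s u z w -> small (u |: S).
Proof.
move=> sS zS wS uS td; apply: (smallU ctx) => //.
  by apply: (small_pair smalls); rewrite cards1.
by have := conn_setU1_triad zS wS uS td; have := conn_small smalls sS; rank_lia.
Qed.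

Lemma fan_end_triad S p q w : fan_end r s del S p q w ->
  exists z u, [/\ z \in [set p; q], z \in S, u \notin S & triangle s u z w].
Proof.
move=> [[pS qS wS] tr [sS lS] [obq wP dw]]; have [pq pw qw _] := tr.
have [||u] := tutte_triangle ctx (x := w) (y := q) (z := p) _ _ obq.
- by permute_triangle.
- exact: (del_obstructed st).
rewrite !inE !negb_or => /andP[/andP[uw uq] up] td.
have [z [zpq zw tdz]] :
    exists z, [/\ z \in [set p; q], z != w & triangle s u z w].
  by case: td => td; [exists q | exists p]; rewrite !inE eqxx ?orbT; split=> //;
     permute_triangle.
have zS : z \in S by move: zpq; rewrite !inE => /orP[]/eqP->.
exists z, u; split=> //; apply/negP=> uS.
have inD v : v \in S -> v != w -> v \in S :\ w by rewrite !inE => -> ->.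
have rS : r S = r (S :\ w).
  rewrite -{1}(setD1K wS); apply: (triangle_rankU1 ctx (y := p) (z := q));
    rewrite ?inD //.
  by permute_triangle.
have sS' : s S = s (S :\ w).
  rewrite -{1}(setD1K wS); apply: (triangle_rankU1 ctxC (y := u) (z := z));
    rewrite ?inD //.
  by permute_triangle.
have := rank_conn M S; have := rank_conn M (S :\ w); rewrite rS sS'.
have cD : 1 < #|S :\ w| by apply/card_gt1P; exists p, q; rewrite !inD.
by have := cardsD1 w S; rewrite wS; have := conn_small_eq2 ctx sS; rank_lia.
Qed.

Lemma fan_end_next S p q w z u : fan_end r s del S p q w -> z \in [set p; q] ->
  u \notin S -> u \notin P -> triangle s u z w ->
    fan_end s r con (u |: S) z w u.
Proof.
move=> [[pS qS wS] tr [sS lS] [_ wP dw]] zpq uS uP td.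
have zS : z \in S by move: zpq; rewrite !inE => /orP[]/eqP->.
split; first by rewrite !inE eqxx zS wS !orbT.
- by permute_triangle.
- split; last by rewrite setU1K // (conn_small smalls).
  exact: small_setU1_triad td.
split=> //; last first.
  apply: (triad_con moves (e := w) (a := z)) (context_notinF ctx uP) => //.
  by permute_triangle.
by apply/existsP; exists [set p; q];
  apply: (triad_obstructs ctxC); permute_triangle.
Qed.

End Fans.

Lemma no_fan_end_meeting_closed r s del con S p q w a : stuck r s del con ->
  fan_end r s del S p q w -> a \in S -> a \in P -> False.
Proof.
have [n] := ubnP #|~: S|.
elim: n r s del con S p q w => // n IHn r s del con S p q w cS st fe aS aP.
have [z [u [zpq zS uS td]]] := fan_end_triad st fe.
have [[_ _ wS] _ [sS _] [_ wP _]] := fe.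
have sU := small_setU1_triad st sS zS wS uS td.
have uP : u \notin P.
  apply/negP=> uP; have ua : u = a; last by rewrite ua aS in uS.
  by apply: (small_meet_closed_uniq (stuck_context st) sU (x := w)) => //;
     rewrite !inE ?eqxx ?wS ?aS ?orbT.
apply: (IHn _ _ _ _ _ _ _ _ _ (stuckC st) (fan_end_next st fe zpq uS uP td)) aP.
  have e : ~: (u |: S) = ~: S :\ u by clear; set_solve.
  by have := cardsD1 u (~: S); rewrite -e inE uS; rank_lia.
by rewrite inE aS orbT.
Qed.

(* Extending one end of a fan leaves the other end alone; once the fan meets
   [P], the end that avoids [P] is impossible. *)
Lemma no_two_fan_ends r s del con S p q w p' q' w' : stuck r s del con ->
  fan_end r s del S p q w -> w' \notin [set p; q; w] ->
    w \notin [set p'; q'; w'] ->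
  fan_end r s del S p' q' w' \/ fan_end s r con S p' q' w' -> False.
Proof.
have [n] := ubnP #|~: S|.
elim: n r s del con S p q w p' q' w' => // n IHn.
move=> r s del con S p q w p' q' w' cS st fe.
have [z [u [zpq zS uS td]]] := fan_end_triad st fe => w'N wN fe'.
have [[_ _ wS] _ [sS _] _] := fe.
have sU := small_setU1_triad st sS zS wS uS td.
have [w'z w'w] : w' != z /\ w' != w.
  move: zpq w'N; rewrite !inE !negb_or => zpq /andP[/andP[w'p w'q] ->].
  by case/orP: zpq => /eqP->.
have feU : fan_end r s del (u |: S) p' q' w' \/
  fan_end s r con (u |: S) p' q' w'.
  have lU : lam (u |: (S :\ w')) <= lam (S :\ w').
    have uD : u \notin S :\ w' by rewrite !inE (negbTE uS) andbF.
    by apply: (conn_setU1_triad st _ _ uD td); rewrite !inE eq_sym ?w'z ?w'w.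
  by case: fe' => fe'; [left|right]; apply: fan_end_setU1 (fe') => //;
     apply: leq_trans lU _; case: fe' => _ _ [].
case: (boolP (u \in P)) => uP.
  by case: feU => feU;
     [apply: (no_fan_end_meeting_closed st feU (a := u)) |
      apply: (no_fan_end_meeting_closed (stuckC st) feU (a := u))];
     rewrite ?setU11.
have feN := fan_end_next st fe zpq uS uP td.
apply: (IHn _ _ _ _ _ _ _ _ p' q' w' _ (stuckC st) feN).
- have e : ~: (u |: S) = ~: S :\ u by clear; set_solve.
  by have := cardsD1 u (~: S); rewrite -e inE uS; rank_lia.
- rewrite !inE !negb_or w'z w'w; apply: contraNneq uS => <-.
  by case: fe' => -[[]].
- have [p'S q'S w'S] : [/\ p' \in S, q' \in S & w' \in S] by case: fe' => -[].
  by rewrite !inE -!orbA; apply: contra uS => /or3P[]/eqP->.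
- by case: feU; [right|left].
Qed.

Section ShortFans.
Variables (r s : {set T} -> nat) (del con : pred T).
Hypothesis st : stuck r s del con.
Let ctx := stuck_context st.
Let ctxC := removal_contextC ctx.
Let moves := context_moves ctx.
Let movesC := context_dual_moves ctx.

Lemma triad_con_of_fan v1 v2 v3 v4 : triangle s v1 v2 v3 ->
  triangle r v2 v3 v4 ->
  v1 \notin F -> v2 \notin F -> v3 \notin F -> con v1.
Proof.
move=> td tr f1 f2 f3; case/orP: (del_or_con moves f2) => [d2|c2].
  by apply: (triad_con moves (e := v2) (a := v3)) => //; permute_triangle.
have d3 : del v3.
  by apply: (triad_con movesC (e := v2) (a := v4)) => //; permute_triangle.
by apply: (triad_con moves (e := v3) (a := v2)) => //; permute_triangle.
Qed.

Lemma triangle_triad_neq v1 v2 v3 v4 : triangle s v1 v2 v3 ->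
  triangle r v2 v3 v4 ->
  v1 != v4.
Proof.
move=> td tr; apply/eqP=> e; rewrite -e in tr.
by apply: (triangle_not_triad ctx (x := v1) (y := v2) (z := v3));
  permute_triangle.
Qed.

Lemma fan_end_four v1 v2 v3 v4 : triangle s v1 v2 v3 -> triangle r v2 v3 v4 ->
  v4 \notin P -> del v4 -> fan_end r s del (v4 |: [set v1; v2; v3]) v2 v3 v4.
Proof.
move=> td tr p4 d4; have sm := triangle_small ctxC td.
have n14 := triangle_triad_neq td tr; have [_ n24 n34 _] := tr.
have v4N : v4 \notin [set v1; v2; v3]
  by rewrite !inE !negb_or !(eq_sym v4) n14 n24.
split=> //; first by rewrite !inE !eqxx !orbT.
  rewrite setU1K // (conn_small (context_small ctx)) //; split=> //.
  have tr' : triangle r v4 v2 v3 by permute_triangle.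
  by apply: (small_setU1_triad (stuckC st) sm _ _ v4N tr');
    rewrite !inE eqxx ?orbT.
split=> //; apply/existsP; exists [set v1; v2].
by apply: (triad_obstructs ctx); permute_triangle.
Qed.

End ShortFans.

Lemma no_four_element_fan r s del con v1 v2 v3 v4 : stuck r s del con ->
  triangle s v1 v2 v3 -> triangle r v2 v3 v4 -> v2 \notin P ->
    v3 \notin P -> False.
Proof.
move=> st td tr p2 p3; have ctx := stuck_context st; have stC := stuckC st.
have [f2 f3] := (context_notinF ctx p2, context_notinF ctx p3).
have [td' tr'] : triangle s v2 v3 v1 /\ triangle r v4 v2 v3
  by split; permute_triangle.
have [n12 n13 _ _] := td; have [_ n24 n34 _] := tr.
have n14 := triangle_triad_neq st td tr.
have eS : v1 |: [set v4; v2; v3] = v4 |: [set v1; v2; v3] by clear; set_solve.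
have end4 : v4 \notin P -> fan_end r s del (v4 |: [set v1; v2; v3]) v2 v3 v4.
  move=> p4; apply: (fan_end_four st) => //.
  exact: (triad_con_of_fan stC tr' td' (context_notinF ctx p4) f2 f3).
have end1 : v1 \notin P -> fan_end s r con (v4 |: [set v1; v2; v3]) v2 v3 v1.
  move=> p1; rewrite -eS; apply: (fan_end_four stC) => //.
  exact: (triad_con_of_fan st td tr (context_notinF ctx p1) f2 f3).
case: (boolP (v4 \in P)) => p4.
  case: (boolP (v1 \in P)) => p1.
    have sm : small (v4 |: [set v1; v2; v3]).
      apply: (small_setU1_triad stC _ _ _ _ tr'); rewrite ?inE ?eqxx ?orbT //.
        exact: (triangle_small (removal_contextC ctx) td).
      by rewrite !negb_or !(eq_sym v4) n14 n24.
    case/negP: n14; apply/eqP.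
    by apply: (small_meet_closed_uniq ctx sm (x := v2)) => //;
      rewrite !inE eqxx ?orbT.
  by apply: (no_fan_end_meeting_closed stC (end1 p1) _ p4); rewrite setU11.
case: (boolP (v1 \in P)) => p1.
  by apply: (no_fan_end_meeting_closed st (end4 p4) _ p1);
    rewrite !inE eqxx orbT.
apply: (no_two_fan_ends st (end4 p4) _ _ (or_intror (end1 p1))).
  by rewrite !inE !negb_or n12 n13 n14.
by rewrite !inE !negb_or !(eq_sym v4) n14 n24 n34.
Qed.

Lemma no_fan_at_closed r s del con e a b c : stuck r s del con ->
  triangle s e a b -> triangle r a b c -> a \in P -> b \notin P -> c \notin P ->
  con b -> False.
Proof.
move=> st td tr aP bP cP cb; have ctx := stuck_context st.
apply: (no_fan_end_meeting_closed st (fan_end_four st td tr cP _) _ aP);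
  last first.
  by rewrite !inE eqxx !orbT.
apply: (triad_con (context_dual_moves ctx) (e := b) (a := a))
    (context_notinF ctx cP) => //.
by permute_triangle.
Qed.

Definition obstruction r s del con A e :=
  (e \notin P) && ((obstructs s A e && del e) || (obstructs r A e && con e)).

Lemma obstructionC r s del con A e :
  obstruction r s del con A e = obstruction s r con del A e.
Proof. by rewrite /obstruction orbC. Qed.

Lemma obstruction_del r s del con A e : e \notin P -> obstructs s A e ->
  del e ->
  obstruction r s del con A e.
Proof. by rewrite /obstruction => -> -> ->. Qed.

Section StuckFacts.
Variables (r s : {set T} -> nat) (del con : pred T).
Hypothesis st : stuck r s del con.
Let ctx := stuck_context st.
Let M := context_ranks ctx.
Let R' := dual_rank M.
Let moves := context_moves ctx.

Lemma obstruction_triad x y z : x \notin P -> del x -> triangle s x y z ->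
  obstruction r s del con [set y; z] x.
Proof.
by move=> xP dx td; apply: obstruction_del => //; apply: (triad_obstructs ctx).
Qed.

Lemma small_setU1_closed_uniq A x y w w' : small A -> x \in A -> y \in A ->
  x != y ->
  x \notin P -> small (w |: A) -> small (w' |: A) -> w \in P ->
    w' \in P -> w = w'.
Proof.
move=> sA xA yA xy xP sw sw' wP wP'.
have sU : small ((w |: A) :|: (w' |: A)).
  by apply: (small_setU ctx sw sw' _ _ xy); rewrite !inE ?xA ?yA !orbT.
by apply: (small_meet_closed_uniq ctx sU (x := x)) => //;
  rewrite !inE ?xA ?eqxx ?orbT.
Qed.

Lemma small_closure_coclosure A a : small A -> small (a |: A) -> a \notin A ->
  1 < #|A| -> r (a |: A) = r A -> s (a |: A) <> s A.
Proof.
move=> sA sU aA cA er es;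
  have cU : #|a |: A| = #|A| + 1 by rewrite cardsU1 aA addnC.
have := conn_small_eq2 ctx sA cA; have := conn_small_eq2 ctx sU; rewrite cU.
by have := rank_conn M (a |: A); have := rank_conn M A;
  rewrite er es cU; rank_lia.
Qed.

Lemma three_element_obstruction A e : obstructs s A e -> del e -> #|A| = 3 ->
  (forall y z, y \in A -> z \in A -> ~ triangle s e y z) ->
  (forall y z, y \in A -> z \in A -> y != z -> y \notin F \/ z \notin F) ->
  [/\ r A <= 2, 2 < s A & forall x, x \in A -> x \notin F -> del x].
Proof.
move=> ob de cA no_triad AF; have [eA _ _ _ /eqP seA] := and5P ob.
have large y z : y \in A -> z \in A -> y != z -> 2 < s [set e; y; z].
  move=> yA zA yz; rewrite ltnNge; apply/negP=> h; apply: (no_triad y z) => //.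
  by split=> //; [move: yA | move: zA]; apply: contraTneq => <-.
have rsA := rank_conn M A; have sA3 := rank_le_card R' A.
have lA : lam A = 2.
  by apply: (conn_small_eq2 ctx (obstructs_small ctx ob)); rewrite cA.
have sA : 2 < s A.
  have [x xA] : exists x, x \in A by apply/card_gt0P; rewrite cA.
  have [y [z [_ _ yz eA3]]] := cards3_mem cA xA.
  rewrite -seA; apply: leq_trans (large y z _ _ yz) _;
    try by rewrite eA3 !inE eqxx ?orbT.
  by apply: (rank_mono R'); rewrite eA3; set_solve.
have rA : r A <= 2 by rank_lia.
split=> // x xA xF; have [y [z [xy xz yz eA3]]] := cards3_mem cA xA.
apply: (quad_del moves (e := e) (y := y) (z := z)) => //.
- by rewrite -eA3.
- by split=> //; rewrite -eA3.
- move=> u; rewrite -eA3 => uA.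
  have [v [w [uv uw vw eu]]] := cards3_mem cA uA.
  have vA : v \in A by rewrite eu !inE eqxx orbT.
  have wA : w \in A by rewrite eu !inE eqxx !orbT.
  have := large v w vA wA vw; have := rank_mono R' (subD1set (e |: A) u).
  have -> : (e |: A) :\ u = [set e; v; w].
    have eu' : e != u by apply: contraNneq eA => ->.
    by rewrite eu; clear -eu' uv uw; set_solve.
  by rewrite seA; rank_lia.
by apply: AF => //; rewrite eA3 !inE eqxx ?orbT.
Qed.

End StuckFacts.

Definition clean_minimal r s del con A := A \subset ~: P /\
  forall A' e, A' \subset ~: P -> obstruction r s del con A' e -> #|A| <= #|A'|.

Lemma clean_minimalC r s del con A :
  clean_minimal r s del con A -> clean_minimal s r con del A.
Proof.
by case=> AP min; split=> // A' e; rewrite -obstructionC; apply: min.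
Qed.

Section CleanMinimal.
Variables (r s : {set T} -> nat) (del con : pred T) (A : {set T}).
Hypothesis st : stuck r s del con.
Hypothesis min : clean_minimal r s del con A.
Let ctx := stuck_context st.

Lemma clean_minimal_notin x : x \in A -> x \notin P.
Proof. by move=> xA; have := subsetP min.1 x xA; rewrite inE. Qed.

Lemma clean_minimal_no_triad x y z : 2 < #|A| -> x \notin P -> y \notin P ->
  z \notin P ->
  del x -> ~ triangle s x y z.
Proof.
move=> cA xP yP zP dx td; have [_ _ yz _] := td.
have yzP : [set y; z] \subset ~: P by rewrite subUset !sub1set !inE yP.
by have := min.2 _ _ yzP (obstruction_triad st xP dx td);
  rewrite cards2 yz; rank_lia.
Qed.

Lemma clean_minimal_triad x : small A -> 3 < #|A| -> x \in A -> del x ->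
  exists y a, [/\ y \in A, a \notin A, a \in P & triangle s x y a].
Proof.
move=> sA cA xA dx; have xP := clean_minimal_notin xA.
have [[A0 subA0 ob]|[y [a [yA aA td]]]] :=
  obstruction_uncross ctx sA xA cA (del_obstructed st xP dx).
  have A0P : A0 \subset ~: P := subset_trans (proper_sub subA0) min.1.
  have := min.2 _ _ A0P (obstruction_del r con xP ob dx).
  by have := proper_card subA0; rank_lia.
exists y, a; split=> //; apply/negPn/negP=> aP.
have yP := clean_minimal_notin yA.
by apply: clean_minimal_no_triad td => //; rank_lia.
Qed.

End CleanMinimal.

Section CleanObstruction.
Variables (r s : {set T} -> nat) (del con : pred T) (A : {set T}) (e : T).
Hypothesis st : stuck r s del con.
Hypothesis min : clean_minimal r s del con A.
Hypotheses (eP : e \notin P) (ob : obstructs s A e) (de : del e).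
Let ctx := stuck_context st.
Let ctxC := removal_contextC ctx.
Let stC := stuckC st.
Let minC := clean_minimalC min.
Let M := context_ranks ctx.
Let moves := context_moves ctx.
Let smA : small A. Proof. exact: (obstructs_small ctx ob). Qed.
Let eA : e \notin A. Proof. by case/and5P: ob. Qed.
Let cA : 1 < #|A|. Proof. by case/and5P: ob. Qed.
Let seA : s (e |: A) = s A. Proof. by case/and5P: ob => _ _ _ _ /eqP. Qed.
Let AF : A \subset ~: F.
Proof.
apply/subsetP=> x xA; rewrite inE; apply: (context_notinF ctx).
exact: (clean_minimal_notin min xA).
Qed.

Lemma clean_obstruction_large_undeletable : 3 < #|A| ->
  forall x, x \in A -> ~~ del x.
Proof.
move=> c3 x' x'A; apply/negP=> dx'.
have [x xA cx] := coclosure_con moves eA AF seA.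
have [y [a [yA aA aP tr]]] := clean_minimal_triad stC minC smA c3 xA cx.
have [y' [a' [y'A a'A a'P td]]] := clean_minimal_triad st min smA c3 x'A dx'.
have xP := clean_minimal_notin min xA; have [xy _ _ _] := tr.
have [tra tda] : triangle r a x y /\ triangle s a' x' y'
  by split; permute_triangle.
have sa := small_setU1_triad stC smA xA yA aA tra.
have sa' := small_setU1_triad st smA x'A y'A a'A tda.
have ea := small_setU1_closed_uniq st smA xA yA xy xP sa sa' aP a'P.
apply: (small_closure_coclosure st smA sa aA cA).
  exact: (triangle_rankU1 ctx tra xA yA).
by rewrite ea; apply: (triangle_rankU1 ctxC tda) x'A y'A.
Qed.

Lemma clean_obstruction_card_le3 : #|A| <= 3.
Proof.
rewrite leqNgt; apply/negP=> c3.
have undel := clean_obstruction_large_undeletable c3.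
have rA := undeletable_rank moves AF undel.
have sA : s A <= 2.
  by have := rank_conn M A; rewrite rA (conn_small_eq2 ctx smA cA); rank_lia.
have /card_gt1P[x [y [xA yA xy]]] := cA.
apply: (clean_minimal_no_triad st min (x := e) (y := x) (z := y)) => //.
- exact: ltnW.
- exact: (clean_minimal_notin min xA).
- exact: (clean_minimal_notin min yA).
split=> //; try by apply: contraNneq eA => ->.
by apply: leq_trans sA; rewrite -seA;
  apply: (rank_mono (dual_rank M)); set_solve.
Qed.

Lemma clean_obstruction_triad : #|A| = 3 -> r A <= 2 ->
  (forall x, x \in A -> del x) ->
  forall x, x \in A -> exists v w,
    [/\ v \in A, w \notin A, w \in P, small (w |: A) & triangle s w x v].
Proof.
move=> c3 rA dA x xA; have [y [z [xy xz yz eA3]]] := cards3_mem c3 xA.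
have tr : triangle r x y z by split=> //; rewrite -eA3.
have inA v : v \in [set x; y; z] -> v \in A by rewrite eA3.
have yA : y \in A by rewrite inA // !inE eqxx orbT.
have zA : z \in A by rewrite inA // !inE eqxx orbT.
have nP := clean_minimal_notin min.
have [w wN td] := tutte_triangle ctx tr (del_obstructed st (nP _ xA) (dA _ xA))
                    (del_obstructed st (nP _ yA) (dA _ yA)).
have [v vA {}td] : exists2 v, v \in A & triangle s x v w
  by case: td; [exists y|exists z].
have td' : triangle s w x v by permute_triangle.
rewrite -eA3 in wN; exists v, w; split=> //.
  apply/negPn/negP=> wP.
  by apply: (clean_minimal_no_triad st min _ _ _ wP _ td); rewrite ?c3 ?nP ?dA.
exact: (small_setU1_triad st smA xA vA wN td').
Qed.

Lemma clean_obstruction_card_neq3 : #|A| <> 3.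
Proof.
move=> c3; have nP := clean_minimal_notin min.
have [||rA sA dA] := three_element_obstruction st ob de c3.
- move=> y z yA zA; apply: (clean_minimal_no_triad st min) => //;
    rewrite ?c3 ?nP //.
- by move=> y z yA _ _; left; apply: (context_notinF ctx); apply: nP.
have {}dA x : x \in A -> del x.
  by move=> xA; apply: dA => //; apply: (context_notinF ctx); apply: nP.
have triad := clean_obstruction_triad c3 rA dA.
have [x xA] : exists x, x \in A by apply/card_gt0P; rewrite c3.
have [v [w [vA _ wP sw td]]] := triad x xA; have [_ _ xv _] := td.
have [o eA3] : exists o, A = [set x; v; o].
  have [y [z [_ _ _ eA3]]] := cards3_mem c3 xA.
  move: vA; rewrite eA3 !inE eq_sym (negbTE xv) /= => /orP[]/eqP->.
    by exists z.
  by exists y; set_solve.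
have oA : o \in A by rewrite eA3 !inE eqxx orbT.
have [v' [w' [v'A _ w'P sw' td']]] := triad o oA; have [_ _ ov' _] := td'.
have ew : w = w' by apply: (small_setU1_closed_uniq st smA xA vA xv (nP _ xA)).
rewrite -ew in td' sw'.
have v'xv : v' \in [set x; v].
  by move: v'A; rewrite eA3 !inE (eq_sym _ o) (negbTE ov') orbF.
have closure_w : s (w |: [set x; v]) = s [set x; v].
  by apply: (triangle_rankU1 ctxC td); rewrite !inE eqxx ?orbT.
have closure_o : s (o |: (w |: [set x; v])) = s (w |: [set x; v]).
  apply: (triangle_rankU1 ctxC (y := w) (z := v')); last exact: setU1r.
    by permute_triangle.
  exact: setU11.
have : s A <= s (o |: (w |: [set x; v])).
  by apply: (rank_mono (dual_rank M)); rewrite eA3; set_solve.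
by have := context_simple ctxC (X := [set x; v]);
  rewrite cards2 xv closure_o closure_w; rank_lia.
Qed.

Lemma no_clean_minimal_obstruction : False.
Proof.
have := clean_obstruction_card_le3; have := clean_obstruction_card_neq3.
have nP := clean_minimal_notin min => c3 c3'; have c2 : #|A| = 2 by rank_lia.
have /card_gt0P[x xA] : 0 < #|A| by rank_lia.
have [y _ eA2] := cards2_mem c2 xA.
have yA : y \in A by rewrite eA2 !inE eqxx orbT.
have td : triangle s e x y by apply: (obstructs_pair_triad ctx); rewrite -eA2.
have [xP yP] := (nP _ xA, nP _ yA).
have cx : con x.
  apply: (triad_con moves (e := e) (a := y)) de (context_notinF ctx xP).
  by permute_triangle.
have cy : con y by apply: (triad_con moves td de (context_notinF ctx yP)).
have td' : triangle s x y e by permute_triangle.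
have [obx oby] := (con_obstructed st xP cx, con_obstructed st yP cy).
have [w _ [tr|tr]] := tutte_triangle ctxC td' obx oby.
  exact: (no_four_element_fan st td tr xP yP).
by apply: (no_four_element_fan (v1 := y) st _ tr xP eP); permute_triangle.
Qed.

End CleanObstruction.

Definition no_clean_obstruction r s del con :=
  forall A e, obstruction r s del con A e -> ~~ (A \subset ~: P).

Lemma no_clean_obstructionC r s del con :
  no_clean_obstruction r s del con -> no_clean_obstruction s r con del.
Proof. by move=> nc A e; rewrite -obstructionC; apply: nc. Qed.

Section NoCleanObstruction.
Variables (r s : {set T} -> nat) (del con : pred T).
Hypothesis st : stuck r s del con.
Hypothesis nc : no_clean_obstruction r s del con.
Let ctx := stuck_context st.

Lemma clean_triad_undeletable x y z : x \notin P -> y \notin P -> z \notin P ->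
  triangle s x y z -> ~~ del x.
Proof.
move=> xP yP zP td; apply/negP=> dx;
  case/negP: (nc (obstruction_triad st xP dx td)).
by rewrite subUset !sub1set !inE yP.
Qed.

Lemma obstruction_meets_closed A e : small (e |: A) ->
  obstruction r s del con A e ->
  exists a, [/\ a \in A, a \in P & forall v, v \in A -> v != a -> v \notin P].
Proof.
move=> sU ob; have eP : e \notin P by case/andP: ob.
have /subsetPn[a aA] := nc ob; rewrite inE negbK => aP.
exists a; split=> // v vA; apply: contraNN => vP; apply/eqP.
by apply: (small_meet_closed_uniq ctx sU (x := e)); rewrite ?setU11 ?setU1r.
Qed.

End NoCleanObstruction.

Section MinimalObstruction.
Variables (r s : {set T} -> nat) (del con : pred T) (A : {set T}) (e : T).
Hypothesis st : stuck r s del con.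
Hypothesis nc : no_clean_obstruction r s del con.
Hypothesis min : forall A' e', obstruction r s del con A' e' -> #|A| <= #|A'|.
Hypotheses (eP : e \notin P) (ob : obstructs s A e) (de : del e).
Let ctx := stuck_context st.
Let ctxC := removal_contextC ctx.
Let M := context_ranks ctx.
Let moves := context_moves ctx.
Let sU : small (e |: A). Proof. by case/and5P: ob. Qed.
Let smA : small A. Proof. exact: (obstructs_small ctx ob). Qed.
Let cA : 1 < #|A|. Proof. by case/and5P: ob. Qed.
Let meet := obstruction_meets_closed st nc sU (obstruction_del r con eP ob de).

Lemma minimal_obstruction_no_triad x y z : 2 < #|A| -> x \notin P -> del x ->
  ~ triangle s x y z.
Proof.
move=> c3 xP dx td; have [_ _ yz _] := td.
by have := min (obstruction_triad st xP dx td); rewrite cards2 yz; rank_lia.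
Qed.

Lemma minimal_obstruction_card_le3 : #|A| <= 3.
Proof.
rewrite leqNgt; apply/negP=> c3; have [a [_ _ nP]] := meet.
have [x xA xa] : exists2 x, x \in A & x != a.
  have /card_gt1P[x [y [xA yA xy]]] := cA.
  by have [xa|] := eqVneq x a; [exists y; rewrite // -xa eq_sym | exists x].
have xP := nP x xA xa.
case/orP: (del_or_con moves (context_notinF ctx xP)) => [dx|cx].
  have [[A0 subA0 ob0]|[y [z [_ _ td]]]] :=
    obstruction_uncross ctx smA xA c3 (del_obstructed st xP dx).
    have := min (obstruction_del r con xP ob0 dx).
    by have := proper_card subA0; rank_lia.
  by apply: minimal_obstruction_no_triad td => //; apply: ltnW.
have [[A0 subA0 ob0]|[y [z [_ _ tr]]]] :=
  obstruction_uncross ctxC smA xA c3 (con_obstructed st xP cx).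
  have := obstruction_del s del xP ob0 cx; rewrite -obstructionC => /min.
  by have := proper_card subA0; rank_lia.
have [_ _ yz _] := tr; have := obstruction_triad (stuckC st) xP cx tr.
by rewrite -obstructionC => /min; rewrite cards2 yz; rank_lia.
Qed.

Lemma minimal_obstruction_card_neq3 : #|A| <> 3.
Proof.
move=> c3; have [a [aA _ nP]] := meet.
have [x [y [ax ay xy eA3]]] := cards3_mem c3 aA.
have xA : x \in A by rewrite eA3 !inE eqxx orbT.
have yA : y \in A by rewrite eA3 !inE eqxx !orbT.
have [xP yP] : x \notin P /\ y \notin P by split; apply: nP; rewrite // eq_sym.
have [||rA _ dA] := three_element_obstruction st ob de c3.
- by move=> u v _ _; apply: minimal_obstruction_no_triad; rewrite ?c3.
- move=> u v uA vA uv; case: (eqVneq u a) => [ua|ua]; [right|left];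
    by apply: (context_notinF ctx); apply: nP; rewrite // -ua eq_sym.
have dx := dA x xA (context_notinF ctx xP).
have dy := dA y yA (context_notinF ctx yP).
have tr : triangle r x y a.
  split; rewrite // 1?eq_sym //; apply: leq_trans rA.
  by apply: (rank_mono (primal_rank M)); rewrite eA3; set_solve.
have [obx oby] := (del_obstructed st xP dx, del_obstructed st yP dy).
have [w _ [td|td]] := tutte_triangle ctx tr obx oby.
  by apply: minimal_obstruction_no_triad td; rewrite ?c3.
by apply: minimal_obstruction_no_triad td; rewrite ?c3.
Qed.

Lemma minimal_obstruction_triad : exists a b,
  [/\ triangle s e a b, a \in P & b \notin P].
Proof.
have := minimal_obstruction_card_le3;
  have := minimal_obstruction_card_neq3 => c3 c3'.
have [a [aA aP nP]] := meet; have c2 : #|A| = 2 by rank_lia.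
have [b ba eA2] := cards2_mem c2 aA; exists a, b; split=> //.
  by apply: (obstructs_pair_triad ctx); rewrite -eA2.
by apply: nP; rewrite // eA2 !inE eqxx orbT.
Qed.

End MinimalObstruction.

Lemma obstructs_splits_triad r s del con A x y z :
  removal_context r s del con ->
  obstructs r A x -> triangle s x y z -> (y \in A) = (z \notin A).
Proof.
move=> ctx ob td; have ctxC := removal_contextC ctx;
  have M := context_ranks ctx.
have [xA _ _ _ /eqP er] := and5P ob; have [xy xz _ _] := td.
have es : s (x |: [set y; z]) = s [set y; z].
  by apply: (triangle_rankU1 ctxC td); rewrite !inE eqxx ?orbT.
have meets Z : x \notin Z -> r (x |: Z) = r Z ->
  ~~ ([set y; z] \subset ~: (x |: Z)).
  by move=> xZ e; apply/negP=> V; have := rankU1_coclosure M xZ V es; rank_lia.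
have xAC : x \notin ~: (x |: A) by rewrite !inE eqxx.
have := meets _ xA er; have := meets _ xAC (obstructs_setC ctxC ob).
rewrite !subUset !sub1set !inE !(eq_sym _ x) (negbTE xy) (negbTE xz) /=.
by case: (y \in A); case: (z \in A).
Qed.

Section PendantTriad.
Variables (r s : {set T} -> nat) (del con : pred T) (e a b : T).
Hypothesis st : stuck r s del con.
Hypothesis nc : no_clean_obstruction r s del con.
Hypotheses (td : triangle s e a b) (aP : a \in P) (bP : b \notin P).
Hypothesis de : del e.
Let ctx := stuck_context st.
Let ctxC := removal_contextC ctx.
Let M := context_ranks ctx.
Let R := primal_rank M.
Let moves := context_moves ctx.
Let movesC := context_dual_moves ctx.
Let stC := stuckC st.
Let ncC := no_clean_obstructionC nc.
Let ab : a != b. Proof. by case: td. Qed.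

Lemma pendant_con : con b.
Proof. exact: (triad_con moves td de (context_notinF ctx bP)). Qed.

Lemma pendant_no_triangle c : c \notin P -> ~ triangle r a b c.
Proof.
by move=> cP tr; apply: (no_fan_at_closed st td tr aP bP cP pendant_con).
Qed.

Lemma pendant_obstruction : exists B,
  [/\ obstructs r B b, a \in B, e \notin B &
      forall v, v \in B -> v != a -> v \notin P].
Proof.
have /existsP[B ob] := con_obstructed st bP pendant_con.
have [_ _ sU _ _] := and5P ob; exists B.
have [a' [a'B a'P nP]] := obstruction_meets_closed stC ncC sU
                            (obstruction_del s del bP ob pendant_con).
have td' : triangle s b a e by permute_triangle.
have split_ae := obstructs_splits_triad ctx ob td'.
have aB : a \in B; last first.
  split=> // [|v vB va]; first by rewrite -split_ae.
  apply: nP => //; apply: contraNneq va => va'; rewrite va' in vB *.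
  by apply/eqP; apply: (small_meet_closed_uniq ctx sU (x := b));
    rewrite ?setU11 ?setU1r.
apply/negPn/negP=> aB.
have eB : e \in B by move: split_ae; rewrite (negbTE aB); case: (e \in B).
have sm : small ((b |: B) :|: [set e; a; b]).
  have [_ eb _ _] := td; apply: (small_setU ctx sU (triangle_small ctxC td)
      _ _ eb);
    by rewrite !inE ?eqxx ?eB ?orbT.
case/negP: aB; rewrite -(_ : a' = a) //.
by apply: (small_meet_closed_uniq ctx sm (x := b)) => //;
  rewrite !inE ?eqxx ?a'B ?orbT.
Qed.

Section Remainder.
Variable B : {set T}.
Hypotheses (ob : obstructs r B b) (aB : a \in B) (eB : e \notin B).
Hypothesis nP : forall v, v \in B -> v != a -> v \notin P.
Let bB : b \notin B. Proof. by case/and5P: ob. Qed.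
Let cB : 1 < #|B|. Proof. by case/and5P: ob. Qed.
Let smB : small B. Proof. exact: (obstructs_small ctxC ob). Qed.
Let aR : a \notin B :\ a. Proof. by rewrite !inE eqxx. Qed.
Let RB : B :\ a \subset B. Proof. exact: subD1set. Qed.
Let cR : #|B| = #|B :\ a| + 1.
Proof. by have := cardsD1 a B; rewrite aB; rank_lia. Qed.
Let RP v : v \in B :\ a -> v \notin P.
Proof. by rewrite !inE => /andP[va vB]; apply: nP. Qed.
Let RF : B :\ a \subset ~: F.
Proof. by apply/subsetP=> v vR; rewrite inE; apply/(context_notinF ctx)/RP. Qed.

Lemma remainder_rank : r B = r (B :\ a) + 1.
Proof.
rewrite -{1}(setD1K aB); apply: (rankU1_coclosure M aR (V := [set e; b])).
  by rewrite setD1K // subUset !sub1set !inE eB.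
by apply: (triangle_rankU1 ctxC (y := e) (z := b));
  rewrite ?inE ?eqxx ?orbT //; permute_triangle.
Qed.

Lemma remainder_card : 1 < #|B :\ a|.
Proof.
rewrite ltnNge; apply/negP=> c1; have c2 : #|B| = 2 by rank_lia.
have [c ca eB2] := cards2_mem c2 aB.
have cP : c \notin P by apply: nP; rewrite // eB2 !inE eqxx orbT.
have tr : triangle r b a c by apply: (obstructs_pair_triad ctxC); rewrite -eB2.
by apply: (pendant_no_triangle cP); permute_triangle.
Qed.

Lemma remainder_corank : small (B :\ a) /\ s B = s (B :\ a).
Proof.
have rB := remainder_rank; have sM := rank_mono (dual_rank M) RB.
have lB := conn_small_eq2 ctx smB cB.
have cBa := rank_conn M (B :\ a); have cBB := rank_conn M B.
have smR : small (B :\ a) by apply: (smallS ctx smB RB); rank_lia.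
by have := conn_small_eq2 ctx smR remainder_card; rank_lia.
Qed.

Let smR := remainder_corank.1.
Let sB := remainder_corank.2.

Lemma remainder_con : exists2 x, x \in B :\ a & con x.
Proof. by apply: (coclosure_con moves aR RF); rewrite setD1K. Qed.

Lemma remainder_card_le3 : #|B :\ a| <= 3.
Proof.
have [x xR cx] := remainder_con; have xP := RP xR.
rewrite leqNgt; apply/negP=> c3.
have [[A0 subA0 ob0]|[y [z [yR _ tr]]]] :=
  obstruction_uncross ctxC smR xR c3 (con_obstructed st xP cx).
  case/negP: (ncC (obstruction_del s del xP ob0 cx)).
  by apply: (subset_trans (proper_sub subA0)); apply/subsetP=> v vR;
    rewrite inE RP.
have yP := RP yR.
have zP : z \in P.
  apply/negPn/negP=> zP.
  by case/negP: (clean_triad_undeletable stC ncC xP yP zP tr).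
have [xB yB] := (subsetP RB x xR, subsetP RB y yR).
have za : z = a.
  have [zB|zB] := boolP (z \in B).
    by apply/eqP/negPn/negP=> za; have := nP zB za; rewrite zP.
  have tr' : triangle r z x y by permute_triangle.
  have sz := small_setU1_triad stC smB xB yB zB tr'.
  by apply: (small_meet_closed_uniq ctx sz (x := x)); rewrite ?setU11 ?setU1r.
have : r (a |: (B :\ a)) = r (B :\ a).
  by apply: (triangle_rankU1 ctx _ xR yR); rewrite -za; permute_triangle.
by rewrite setD1K // remainder_rank; rank_lia.
Qed.

Lemma remainder_card_neq3 : #|B :\ a| <> 3.
Proof.
move=> c3; have [x xR cx] := remainder_con.
have [y [z [xy xz yz eR]]] := cards3_mem c3 xR.
have [xP yP zP] : [/\ x \notin P, y \notin P & z \notin P].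
  by split; apply: RP; rewrite eR !inE eqxx ?orbT.
have l2 := conn_small_eq2 ctx smR remainder_card; have := rank_conn M (B :\ a).
rewrite l2 c3 eR => rs; have [rR|rR] := leqP (r [set x; y; z]) 2.
  by case/negP: (clean_triad_undeletable stC ncC xP yP zP (And4 xy xz yz rR)).
have tdR : triangle s x y z by split=> //; rank_lia.
have tdR' : triangle s y x z by permute_triangle.
have cy : con y.
  have := del_or_con moves (context_notinF ctx yP).
  by rewrite (negbTE (clean_triad_undeletable st nc yP xP zP tdR')).
have [obx oby] := (con_obstructed st xP cx, con_obstructed st yP cy).
have [w _ [tr|tr]] := tutte_triangle ctxC tdR obx oby.
  by apply: (no_four_element_fan (v1 := z) st _ tr xP yP); permute_triangle.
by apply: (no_four_element_fan (v1 := y) st _ tr xP zP); permute_triangle.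
Qed.

Lemma remainder_pair_con x y : B :\ a = [set x; y] -> x != y -> con x -> con y.
Proof.
move=> eR xy cx; have [xP yP] : x \notin P /\ y \notin P.
  by split; apply: RP; rewrite eR !inE eqxx ?orbT.
have [xa ya] : x != a /\ y != a
  by split; [apply: contraNneq xP|apply: contraNneq yP] => ->.
have eB3 : B = [set y; x; a] by rewrite -(setD1K aB) eR; clear; set_solve.
have sR : s [set y; x; a] <= 2.
  by rewrite -eB3 sB eR; have := rank_le_card (dual_rank M) [set x; y];
    rewrite cards2 xy.
have bN : b \notin [set y; x; a] by rewrite -eB3.
have rB : r (b |: B) = 3.
  have [_ _ _ _ /eqP->] := and5P ob; rewrite remainder_rank eR.
  by rewrite (context_simple ctx) cards2 xy.
have [bx by_] : b != x /\ b != y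
  by move: bN; rewrite !inE !negb_or => /andP[/andP[]].
have ax : a != x by rewrite eq_sym.
have ay : a != y by rewrite eq_sym.
have large u v w : [set u; v; w] \subset b |: B -> u != v -> u != w -> v != w ->
    ~ triangle r u v w -> r [set u; v; w] = r (b |: B).
  move=> sub uv uw vw no; have := rank_mono R sub; rewrite rB.
  by case: (leqP (r [set u; v; w]) 2) => h; [case: no | rank_lia].
apply: (quad_del movesC bN (y := x) (z := a)) pendant_con
    (context_notinF ctx yP) _.
- by split; rewrite // eq_sym.
- rewrite -eB3 => u; rewrite {1}eB3 !inE -orbA => /or3P[]/eqP->.
  + have -> : (b |: B) :\ y = [set a; b; x].
      by rewrite eB3; clear -xy ya by_; set_solve.
    by apply: large => //; [rewrite eB3; clear; set_solve |
      apply: pendant_no_triangle].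
  + have -> : (b |: B) :\ x = [set a; b; y].
      by rewrite eB3; clear -xy xa bx; set_solve.
    by apply: large => //; [rewrite eB3; clear; set_solve |
      apply: pendant_no_triangle].
  have -> : (b |: B) :\ a = [set b; x; y].
    by rewrite eB3; clear -ab xa ya; set_solve.
  apply: large => //; first by rewrite eB3; clear; set_solve.
  move=> tr; case/negP: (clean_triad_undeletable stC ncC bP xP yP tr).
  exact: pendant_con.
by left; apply: (context_notinF ctx).
Qed.

Lemma remainder_card_neq2 : #|B :\ a| <> 2.
Proof.
move=> c2; have [x xR cx] := remainder_con; have [y yx eR] := cards2_mem c2 xR.
have xy : x != y by rewrite eq_sym.
have yR : y \in B :\ a by rewrite eR !inE eqxx orbT.
have [xP yP] := (RP xR, RP yR); have cy := remainder_pair_con eR xy cx.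
have [xa ya] : x != a /\ y != a
  by split; [apply: contraNneq xP|apply: contraNneq yP] => ->.
have tdB : triangle s x y a.
  split=> //; have -> : [set x; y; a] = B by rewrite -(setD1K aB) eR setUC.
  by rewrite sB eR; have := rank_le_card (dual_rank M) [set x; y];
    rewrite cards2 xy.
have [obx oby] := (con_obstructed st xP cx, con_obstructed st yP cy).
have [w _ [tr|tr]] := tutte_triangle ctxC tdB obx oby.
  by apply: (no_four_element_fan (v1 := a) st _ tr xP yP); permute_triangle.
have [_ _ aw _] := tr; have sm := triangle_small ctx tr.
have wP : w \notin P.
  apply: contraNN aw => wP; apply/eqP.
  by apply: (small_meet_closed_uniq ctx sm (x := x)) => //;
    rewrite !inE eqxx ?orbT.
by apply: (no_fan_at_closed (e := y) (b := x) st _ _ aP xP wP cx);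
  permute_triangle.
Qed.

End Remainder.

Lemma no_pendant_triad : False.
Proof.
have [B [ob aB eB nP]] := pendant_obstruction.
have := remainder_card ob aB nP; have := remainder_card_le3 ob aB eB nP.
have := remainder_card_neq3 ob aB eB nP;
  have := remainder_card_neq2 ob aB eB nP.
by rank_lia.
Qed.

End PendantTriad.

Lemma minimal_obstruction_clean r s del con A e : stuck r s del con ->
  (forall A' e', obstruction r s del con A' e' -> #|A| <= #|A'|) ->
  obstruction r s del con A e -> ~ no_clean_obstruction r s del con.
Proof.
move=> st min /andP[eP /orP[]/andP[ob de]] nc.
  have [a [b [td aP bP]]] := minimal_obstruction_triad st nc min eP ob de.
  exact: no_pendant_triad st nc td aP bP de.
have ncC := no_clean_obstructionC nc.
have minC A' e' : obstruction s r con del A' e' -> #|A| <= #|A'|.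
  by rewrite -obstructionC; apply: min.
have [a [b [td aP bP]]] :=
  minimal_obstruction_triad (stuckC st) ncC minC eP ob de.
exact: no_pendant_triad (stuckC st) ncC td aP bP de.
Qed.

Lemma not_stuck r s del con e : e \notin P -> ~ stuck r s del con.
Proof.
move=> eP st; have ctx := stuck_context st.
pose obs (A : {set T}) := [exists f, obstruction r s del con A f].
have [A obA] : exists A, obs A.
  case/orP: (del_or_con (context_moves ctx) (context_notinF ctx eP)) => [de|ce].
    have /existsP[A ob] := del_obstructed st eP de.
    by exists A; apply/existsP; exists e; apply: obstruction_del.
  have /existsP[A ob] := con_obstructed st eP ce.
  by exists A; apply/existsP; exists e; rewrite obstructionC;
    apply: obstruction_del.
pose clean (A : {set T}) := (A \subset ~: P) && obs A.
have [/existsP[A0 cleanA0]|noclean] := boolP [exists A, clean A].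
  case: (arg_minnP (P := clean) (fun A : {set T} => #|A|) cleanA0).
  move=> B /andP[BP /existsP[f /andP[fP obB]]] minB.
  have min : clean_minimal r s del con B.
    split=> // A' e' A'P ob'; apply: minB; rewrite /clean A'P.
    by apply/existsP; exists e'.
  case/orP: obB => /andP[ob df].
    exact: no_clean_minimal_obstruction st min fP ob df.
  exact: no_clean_minimal_obstruction (stuckC st) (clean_minimalC min) fP ob df.
have nc : no_clean_obstruction r s del con.
  move=> A' e' ob'; apply: contraNN noclean => A'P.
  by apply/existsP; exists A'; rewrite /clean A'P; apply/existsP; exists e'.
case: (arg_minnP (P := obs) (fun A : {set T} => #|A|) obA) =>
  B /existsP[f obB] minB.
apply: (minimal_obstruction_clean st _ obB nc) => A' e' ob'.
by apply: minB; apply/existsP; exists e'.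
Qed.

Theorem unobstructed_removal r s del con e : removal_context r s del con ->
  e \notin P ->
  exists2 f, f \notin P &
    del f && ~~ obstructed s f || con f && ~~ obstructed r f.
Proof.
move=> ctx eP; apply/exists_inP; apply: contraT => /exists_inPn no.
case: (@not_stuck r s del con e eP); split=> // x xP dx; apply: contraT => nob;
  by case/negP: (no x xP); rewrite dx nob ?orbT.
Qed.

Section UnobstructedDeletion.
Variables (r s : {set T} -> nat) (del con : pred T) (x : T) (A B : {set T}).
Hypothesis ctx : removal_context r s del con.
Hypotheses (xA : x \notin A) (eB : B = ~: (x |: A)).
Let M := context_ranks ctx.
Let R := primal_rank M.
Let eAC : ~: A = x |: B. Proof. by rewrite eB; clear -xA; set_solve. Qed.
Let eBC : ~: B = x |: A. Proof. by rewrite eB setCK. Qed.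
Let xB : x \notin B. Proof. by rewrite eB !inE eqxx. Qed.
Let cxA : #|x |: A| = #|A| + 1. Proof. by rewrite cardsU1 xA addnC. Qed.
Let cxB : #|x |: B| = #|B| + 1. Proof. by rewrite cardsU1 xB addnC. Qed.

Lemma rank_deletion_ge1 : 0 < #|A| -> 0 < #|B| -> r setT + 1 <= r A + r B.
Proof.
move=> cA cB; have cx : 2 < #|~: [set x]|.
  by apply: (card_setC_small ctx); rewrite (small_pair (context_small ctx))
      ?cards1.
have cAB : #|~: [set x]| = #|A| + #|B|.
  rewrite -card_setU_disjoint eB; last by clear; set_solve.
  by congr #|pred_of_set _|; clear -xA; set_solve.
have := connE M A; have := connE M B; rewrite eAC eBC.
have := rankU1 R x A; have := rankU1 R x B.
have := conn_ge2 ctx (A := A); have := conn_ge2 ctx (A := B).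
by rewrite eAC eBC cxA cxB; rank_lia.
Qed.

Lemma unobstructed_rank_deletion : ~~ obstructed s x -> 1 < #|A| -> 1 < #|B| ->
  r setT + 2 <= r A + r B.
Proof.
move=> /existsPn unob cA cB; rewrite leqNgt; apply/negP=> lt.
have lxA := connE M (x |: A); have lA := connE M A; rewrite -eB eAC in lxA lA.
have uA := rankU1 R x A; have uB := rankU1 R x B.
have gxA : 2 <= lam (x |: A)
  by apply: (conn_ge2 ctx); rewrite -?eB ?cxA //; rank_lia.
have gA : 2 <= lam A by apply: (conn_ge2 ctx); rewrite ?eAC ?cxB //; rank_lia.
have not_small Z : x \notin Z -> 1 < #|Z| -> lam Z = 2 -> lam (x |: Z) = 2 ->
    r (x |: Z) = r Z + 1 -> ~~ small (x |: Z).
  move=> xZ cZ lZ lxZ rZ; apply: contraNN (unob Z) => sZ.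
  rewrite /obstructs xZ cZ sZ lZ /=; apply/eqP.
  by have := rank_conn M Z; have := rank_conn M (x |: Z);
    rewrite cardsU1 xZ; rank_lia.
have lxA2 : lam (x |: A) <= 2 by rank_lia.
case/orP: (small_or_setC (context_small ctx) lxA2) => [sA|].
  by move: sA; apply/negP/(not_small A xA cA); rank_lia.
have lxB : lam (x |: B) = lam A by rewrite -eAC (conn_setC M).
have lB : lam B = lam (x |: A) by rewrite -eBC (conn_setC M).
rewrite -eB => sB; have : small (x |: B).
  apply: (smallU ctx) sB _; last by rank_lia.
  by rewrite (small_pair (context_small ctx)) ?cards1.
by apply/negP/(not_small B xB cB); rank_lia.
Qed.

End UnobstructedDeletion.

Lemma unobstructed_deletion r s del con x : removal_context r s del con ->
  ~~ obstructed s x -> minor_connected3 r [set x] set0.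
Proof.
move=> ctx unob k A /andP[k0 k3]; rewrite !setU0 => xA cA cB.
have {}xA : x \notin A
  by have := subsetP xA x; rewrite !inE eqxx => /contraTN->.
have R := primal_rank (context_ranks ctx); rewrite (rank0 R) addn0.
have := rank_deletion_ge1 ctx xA (erefl _);
  have := unobstructed_rank_deletion ctx xA (erefl _) unob.
have := rank_leT R (~: [set x]); case: k k0 k3 cA cB => [|[|[|]]] //= *;
  rank_lia.
Qed.

End OneElement.

(** * Realizing a fixed minor *)

Section Realizers.
Variables (T : finType) (F : {set T}) (lam : {set T} -> nat).
Implicit Types (A C D V W Z : {set T}) (e u v w x y z : T).
Implicit Types (r s rho : {set T} -> nat).

(* [C] realizes the minor with rank function [rho] on [F] as the restriction of
   [M / C] to [F]; the deleted set is the complement of [F :|: C]. *)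
Definition realizes r rho C :=
  (C \subset ~: F) &&
  [forall W : {set T}, (W \subset F) ==> (rho W + r C == r (W :|: C))].

Definition deletable r rho x :=
  (x \notin F) && [exists C, realizes r rho C && (x \notin C)].

Definition contractible r rho x := [exists C, realizes r rho C && (x \in C)].

Definition dual_on rho W := #|W| + rho (F :\: W) - rho F.

Record realized_minor r s rho : Prop := {
  realized_ranks : dual_ranks lam r s;
  realized_simple : simple_rank r;
  realized_cosimple : simple_rank s;
  realized_loopless : forall x, x \in F -> 0 < rho [set x];
  realized_coloopless : forall x, x \in F -> rho F <= rho (F :\ x);
  realized_ex : exists C, realizes r rho C
}.

Lemma realizesP r rho C :
  reflect (C \subset ~: F /\ forall W, W \subset F -> rho W + r C = r (W :|: C))
          (realizes r rho C).
Proof.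
apply: (iffP andP) => -[CF rhoE]; split=> //.
  by move=> W WF; move/forallP: rhoE => /(_ W); rewrite WF => /eqP.
by apply/forallP=> W; apply/implyP=> WF; rewrite rhoE.
Qed.

Lemma eq_realizes r rho rho' C : (forall W, W \subset F -> rho W = rho' W) ->
  realizes r rho C = realizes r rho' C.
Proof.
move=> e; rewrite /realizes; congr (_ && _); apply: eq_forallb => W.
by case: (boolP (W \subset F)) => // /e->.
Qed.

Lemma setCU_K C : C \subset ~: F -> ~: (F :|: ~: (F :|: C)) = C.
Proof. by move=> CF; set_solve. Qed.

Lemma setU1_or_setD1 x C : x |: C = C \/ C :\ x = C.
Proof.
by case: (boolP (x \in C)) => xC; [left | right]; set_solve.
Qed.

Section RealizedMinor.
Variables r s rho : {set T} -> nat.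
Hypothesis N : realized_minor r s rho.
Let M := realized_ranks N.
Let R := primal_rank M.
Let real := realizes r rho.

Lemma realizes_closure_notin C V x : real C -> V \subset C ->
  r (x |: V) = r V ->
  x \notin F.
Proof.
case/realizesP=> _ rhoE VC e; apply/negP=> xF.
have := rhoE [set x]; rewrite sub1set xF => /(_ isT).
by have := realized_loopless N xF; have := rank_closureS R VC e; rank_lia.
Qed.

Lemma realizes_closure C V x : V \subset C :\ x -> r (x |: V) = r V ->
  real (x |: C) = real (C :\ x).
Proof.
move=> VC e; have [xF|xF] := boolP (x \in F).
  have -> : real (C :\ x) = false.
    by apply/negP=> rC; have := realizes_closure_notin rC VC e; rewrite xF.
  by apply/negP=> /realizesP[/subsetP/(_ x (setU11 _ _))]; rewrite inE xF.
have rW W : r (W :|: (x |: C)) = r (W :|: C :\ x).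
  have -> : W :|: (x |: C) = x |: (W :|: C :\ x) by clear; set_solve.
  by apply: (rank_closureS R _ e); apply: subset_trans VC (subsetUr _ _).
have rC : r (x |: C) = r (C :\ x) by have := rW set0; rewrite !set0U.
apply/realizesP/realizesP=> -[CF rhoE]; split=> [|W /rhoE]; rewrite ?rW ?rC //.
  by clear -CF; set_solve.
by clear -CF xF; set_solve.
Qed.

Lemma realizes_closure_toggle C V x : real C -> V \subset C :\ x ->
  r (x |: V) = r V -> real (x |: C) /\ real (C :\ x).
Proof.
move=> rC VC /(realizes_closure VC).
by case: (setU1_or_setD1 x C) => -> e; [rewrite -e | rewrite e].
Qed.

Lemma realizes_setC C : real C -> realizes s (dual_on rho) (~: (F :|: C)).
Proof.
case/realizesP=> CF rhoE; apply/realizesP; split=> [|W WF];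
  first by clear; set_solve.
have rhoF := rhoE F (subxx _); have rhoFW := rhoE _ (subsetDl F W).
have dC := rank_dual M (~: (F :|: C));
  have dW := rank_dual M (W :|: ~: (F :|: C)).
have mono := rank_mono (dual_rank M) (subsetUr W (~: (F :|: C))).
have cW : #|W :|: ~: (F :|: C)| = #|W| + #|~: (F :|: C)|.
  by apply: card_setU_disjoint; clear -WF; set_solve.
have eW : ~: (W :|: ~: (F :|: C)) = (F :\: W) :|: C by clear -WF CF; set_solve.
by rewrite setCK in dC; rewrite eW cW in dW; rewrite /dual_on; rank_lia.
Qed.

Lemma dual_on_le W : W \subset F -> rho F <= #|W| + rho (F :\: W).
Proof.
move=> WF; have [C /realizesP[_ rhoE]] := realized_ex N.
have := rhoE F (subxx _); have := rhoE _ (subsetDl F W).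
have := rankU R W ((F :\: W) :|: C); have := rank_le_card R W.
have -> : W :|: ((F :\: W) :|: C) = F :|: C by clear -WF; set_solve.
by rank_lia.
Qed.

Lemma dual_onK W : W \subset F -> dual_on (dual_on rho) W = rho W.
Proof.
move=> WF; have [C /realizesP[_ rhoE]] := realized_ex N.
have r0 : rho set0 = 0 by have := rhoE _ (sub0set F); rewrite set0U; rank_lia.
have eW : F :\: (F :\: W) = W by clear -WF; set_solve.
have := dual_on_le (subxx F); have := dual_on_le (subsetDl F W).
have cW : #|F| = #|W| + #|F :\: W|.
  by have := cardsID W F; rewrite (setIidPr WF).
by rewrite /dual_on eW setDv r0 cW; rank_lia.
Qed.

Lemma realized_minorC : realized_minor s r (dual_on rho).
Proof.
have [C rC] := realized_ex N; have [_ rhoE] := realizesP _ _ _ rC.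
have r0 : rho set0 = 0 by have := rhoE _ (sub0set F); rewrite set0U; rank_lia.
split=> [||| x xF | x xF |].
- exact: dual_ranksC.
- exact: realized_cosimple N.
- exact: realized_simple N.
- by have := realized_coloopless N xF; rewrite /dual_on cards1; rank_lia.
- have := realized_loopless N xF; rewrite /dual_on setDv r0.
  have -> : F :\: (F :\ x) = [set x] by clear -xF; set_solve.
  by have := cardsD1 x F; rewrite xF; rank_lia.
by exists (~: (F :|: C)); apply: realizes_setC.
Qed.

End RealizedMinor.

Section DualMoves.
Variables r s rho : {set T} -> nat.
Hypothesis N : realized_minor r s rho.
Let NC := realized_minorC N.

Lemma realizes_dual C : C \subset ~: F ->
  realizes s (dual_on rho) (~: (F :|: C)) = realizes r rho C.
Proof.
move=> CF; apply/idP/idP=> [rD|]; last exact: realizes_setC.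
by have := realizes_setC NC rD;
  rewrite setCU_K // (eq_realizes _ _ (dual_onK N)).
Qed.

Lemma deletable_dual x : deletable s (dual_on rho) x = contractible r rho x.
Proof.
apply/andP/existsP=> [[xF /existsP[D /andP[rD xD]]]|[C /andP[rC xC]]].
  have [DF _] := realizesP _ _ _ rD; exists (~: (F :|: D)).
  by rewrite -realizes_dual ?setCU_K ?rD ?inE ?negb_or ?xF //; clear; set_solve.
have [CF _] := realizesP _ _ _ rC; split.
  by move: (subsetP CF x xC); rewrite inE.
by apply/existsP; exists (~: (F :|: C));
  rewrite realizes_dual // rC !inE xC orbT.
Qed.

Lemma contractible_dual x : contractible s (dual_on rho) x = deletable r rho x.
Proof.
apply/existsP/andP=> [[D /andP[rD xD]]|[xF /existsP[C /andP[rC xC]]]].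
  have [DF _] := realizesP _ _ _ rD; split.
    by move: (subsetP DF x xD); rewrite inE.
  apply/existsP; exists (~: (F :|: D));
    rewrite -realizes_dual ?setCU_K ?rD ?inE ?xD ?orbT //.
  by clear; set_solve.
have [CF _] := realizesP _ _ _ rC; exists (~: (F :|: C)).
by rewrite realizes_dual // rC !inE negb_or xF.
Qed.

Lemma realizes_coclosure_notin C V x : realizes r rho C ->
  V \subset ~: (F :|: C) ->
  s (x |: V) = s V -> x \notin F.
Proof.
by move=> rC; apply: (realizes_closure_notin NC); apply: (realizes_setC N).
Qed.

Lemma realizes_coclosure C V x : C \subset ~: F -> x \notin F ->
  V \subset ~: (x |: (F :|: C)) -> s (x |: V) = s V ->
  realizes r rho (x |: C) = realizes r rho (C :\ x).
Proof.
move=> CF xF VC e; rewrite -!realizes_dual; try by clear -CF xF; set_solve.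
have <- : ~: (F :|: C) :\ x = ~: (F :|: (x |: C)) by clear -xF; set_solve.
have <- : x |: ~: (F :|: C) = ~: (F :|: C :\ x) by clear -xF; set_solve.
symmetry; apply: (realizes_closure NC (V := V)) => //.
by apply: subset_trans VC _; clear; set_solve.
Qed.

Lemma realizes_coclosure_toggle C V x : realizes r rho C -> x \notin F ->
  V \subset ~: (x |: (F :|: C)) -> s (x |: V) = s V ->
  realizes r rho (x |: C) /\ realizes r rho (C :\ x).
Proof.
move=> rC xF VC /(realizes_coclosure (proj1 (realizesP _ _ _ rC)) xF VC).
by case: (setU1_or_setD1 x C) => -> e; [rewrite -e | rewrite e].
Qed.

End DualMoves.

Lemma realized_triangle r s rho x y z : realized_minor r s rho ->
  triangle r x y z ->
  r (x |: [set y; z]) = r [set y; z].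
Proof.
move=> N tr; have R := primal_rank (realized_ranks N).
by apply: (triangle_closure R (realized_simple N) tr); rewrite !inE eqxx ?orbT.
Qed.

Section Moves.
Variables r s rho : {set T} -> nat.
Hypothesis N : realized_minor r s rho.
Let M := realized_ranks N.
Let R := primal_rank M.
Let R' := dual_rank M.
Let NC := realized_minorC N.

Lemma realized_triad_con e a b : triangle s e a b -> deletable r rho e ->
  b \notin F ->
  contractible r rho b.
Proof.
move=> td /andP[eF /existsP[C /andP[rC eC]]] bF; apply/existsP.
case: (boolP (b \in C)) => bC; first by exists C; rewrite rC.
have [tda tdb] : triangle s a e b /\ triangle s b e a
  by split; permute_triangle.
have [ae ab _ _] := tda; have [be _ _ _] := tdb.
have ebC : [set e; b] \subset ~: (a |: (F :|: C)).
  by clear -ae ab eF eC bF bC; set_solve.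
have esa := realized_triangle NC tda.
have aF : a \notin F.
  apply: (realizes_coclosure_notin N rC _ esa).
  by apply: subset_trans ebC _; clear; set_solve.
have [_ rC'] := realizes_coclosure_toggle N rC aF ebC esa.
have eaC : [set e; a] \subset ~: (b |: (F :|: C :\ a)).
  by clear -ae ab be eF eC aF; set_solve.
exists (b |: C :\ a); rewrite setU11 andbT.
have [] // := realizes_coclosure_toggle N rC' bF eaC.
by rewrite (setUC [set e]) (realized_triangle NC) //; permute_triangle.
Qed.

Lemma realized_undeletable_rank A : A \subset ~: F ->
  (forall x, x \in A -> ~~ deletable r rho x) -> r A = #|A|.
Proof.
move=> AF undel; apply: (rank_eq_card R) => x xA; rewrite ltnNge;
  apply/negP=> rA_le.
have [C rC] := realized_ex N.
have notF y : y \in A -> y \notin F by move/(subsetP AF); rewrite inE.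
have AC : A \subset C.
  apply/subsetP=> y yA; apply: contraT => yC; case/negP: (undel y yA).
  by rewrite /deletable notF //; apply/existsP; exists C; rewrite rC.
have e : r (x |: A :\ x) = r (A :\ x).
  by rewrite setD1K //; have := rank_mono R (subD1set A x); rank_lia.
have [_ rC'] := realizes_closure_toggle N rC (setSD [set x] AC) e.
case/negP: (undel x xA); rewrite /deletable notF //; apply/existsP.
by exists (C :\ x); rewrite rC' !inE eqxx.
Qed.

Lemma realized_coclosure_con a A : a \notin A -> A \subset ~: F ->
  s (a |: A) = s A ->
  exists2 x, x \in A & contractible r rho x.
Proof.
move=> aA AF e; have [C rC] := realized_ex N.
have [AC|/set0Pn[x /setIP[xA xC]]] := eqVneq (A :&: C) set0; last first.
  by exists x => //; apply/existsP; exists C; rewrite rC.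
have ANC : A \subset ~: (F :|: C)
  by rewrite setCU subsetI AF -disjoints_subset -setI_eq0 AC eqxx.
have aF := realizes_coclosure_notin N rC ANC e.
have [|_ rCa] := realizes_coclosure_toggle N rC aF _ e.
  by clear -ANC aA; set_solve.
have [A0 /minsetP[/eqP eA0 minA0] A0A] :
    {A0 : {set T} | minset (fun B => s (a |: B) == s B) A0 & A0 \subset A}.
  by apply: minset_exists; apply/eqP.
have /set0Pn[x xA0] : A0 != set0.
  apply: contra_eqN eA0 => /eqP->; rewrite setU0 (realized_cosimple N)
      ?cards1 //.
  by rewrite (rank0 R').
have [xA sxA0] := (subsetP A0A x xA0, rankU1 R' x (A0 :\ x)).
have xF : x \notin F by have := subsetP AF x xA; rewrite inE.
have exch : s (x |: (a |: A0 :\ x)) = s (a |: A0 :\ x).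
  have ne : s (a |: A0 :\ x) != s (A0 :\ x).
    by apply/negP=> /minA0/(_ (subD1set _ _)) /setP/(_ x);
      rewrite !inE eqxx xA0.
  have -> : x |: (a |: A0 :\ x) = a |: A0 by clear -xA0; set_solve.
  have := rankU1 R' a (A0 :\ x); rewrite setD1K // in sxA0.
  have : s (a |: A0 :\ x) <= s (a |: A0)
    by apply: (rank_mono R'); clear; set_solve.
  by move/eqP: ne; rewrite eA0; rank_lia.
exists x => //; apply/existsP; exists (x |: C :\ a); rewrite setU11 andbT.
have xa : x != a by apply: contraNneq aA => <-.
have [] // := realizes_coclosure_toggle N rCa xF _ exch.
by clear -xa xF aF ANC A0A; set_solve.
Qed.

Section Quad.
Variables (e x v w : T) (C : {set T}).
Hypotheses (tr : triangle r x v w) (rC : realizes r rho C) (xC : x \in C).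
Hypothesis quad : forall u, u \in [set x; v; w] ->
  s ((e |: [set x; v; w]) :\ u) = s (e |: [set x; v; w]).

Lemma quad_drop_contracted : v \in C ->
  exists2 C', realizes r rho C' & x \notin C'.
Proof.
move=> vC; have [xv xw vw _] := tr;
  have tr' : triangle r w x v by permute_triangle.
have [|rwC _] := realizes_closure_toggle N rC _ (realized_triangle N tr').
  by clear -xC vC xw vw; set_solve.
have [|_ rC'] := realizes_closure_toggle N rwC _ (realized_triangle N tr).
  by clear -vC xv xw; set_solve.
by exists ((w |: C) :\ x); rewrite // !inE eqxx.
Qed.

Lemma quad_coclosure u : u \in [set x; v; w] ->
  s (u |: (e |: [set x; v; w]) :\ u) = s ((e |: [set x; v; w]) :\ u).
Proof. by move=> uQ; rewrite setD1K ?quad // inE uQ orbT. Qed.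

Lemma quad_rankU1 u Z : u \in [set x; v; w] -> u \notin Z ->
  Z \subset ~: (e |: [set x; v; w]) -> r (u |: Z) = r Z + 1.
Proof.
move=> uQ uZ ZQ; apply: (rankU1_coclosure M uZ _ (quad_coclosure uQ)).
by clear -ZQ; set_solve.
Qed.

Lemma quad_drop_free : x \notin F -> [set e; v; w] \subset ~: (F :|: C) ->
  exists2 C', realizes r rho C' & x \notin C'.
Proof.
move=> xF evwC; have xQ : x \in [set x; v; w] by rewrite !inE eqxx.
have [|_ rC'] := realizes_coclosure_toggle N rC xF _ (quad_coclosure xQ).
  by clear -evwC; set_solve.
by exists (C :\ x); rewrite // !inE eqxx.
Qed.

(* [x] is parallel to [w] once [v], which lies in [F], is spanned; the coclosure
   conditions make the exchange harmless for the subsets of [F] avoiding [v]. *)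
Lemma quad_exchange : v \in F -> v \notin C ->
  [set e; w] \subset ~: (F :|: C) ->
  exists2 C', realizes r rho C' & x \notin C'.
Proof.
move=> vF vC ewC; have [_ xw _ _] := tr; have [CF rhoE] := realizesP _ _ _ rC.
exists (w |: C :\ x); last by rewrite !inE eqxx (negbTE xw).
have tr' : triangle r w x v by permute_triangle.
have CQ : C :\ x \subset ~: (e |: [set x; v; w]) by clear -CF vF ewC; set_solve.
have xN : x \notin C :\ x by rewrite !inE eqxx.
have wN : w \notin C :\ x by clear -ewC; set_solve.
have xQ : x \in [set x; v; w] by rewrite !inE eqxx.
have wQ : w \in [set x; v; w] by rewrite !inE eqxx !orbT.
have rxC : r C = r (C :\ x) + 1 by rewrite -{1}(setD1K xC) quad_rankU1.
have rwC := quad_rankU1 wQ wN CQ.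
apply/realizesP; split=> [|W WF]; first by clear -CF ewC; set_solve.
have := rhoE W WF; rewrite rxC rwC => ->; have [vW|vW] := boolP (v \in W).
  have V1 : [set x; v] \subset W :|: C by clear -xC vW; set_solve.
  have V2 : [set v; w] \subset W :|: (w |: C :\ x) by clear -vW; set_solve.
  have := rank_closureS R V1 (realized_triangle N tr').
  have := rank_closureS R V2 (realized_triangle N tr).
  by have -> : x |: (W :|: (w |: C :\ x)) = w |: (W :|: C)
    by [clear -xC; set_solve]; rank_lia.
have WQ : W :|: C :\ x \subset ~: (e |: [set x; v; w]).
  by clear -CQ WF vW CF xC ewC; set_solve.
have xWN : x \notin W :|: C :\ x by clear -CF xC WF; set_solve.
have wWN : w \notin W :|: C :\ x by clear -WF ewC; set_solve.
have -> : W :|: C = x |: (W :|: C :\ x) by clear -xC; set_solve.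
have -> : W :|: (w |: C :\ x) = w |: (W :|: C :\ x) by clear; set_solve.
by rewrite !quad_rankU1.
Qed.

End Quad.

Lemma realized_quad_del e x y z : e \notin [set x; y; z] -> triangle r x y z ->
  (forall u, u \in [set x; y; z] ->
     s ((e |: [set x; y; z]) :\ u) = s (e |: [set x; y; z])) ->
  deletable r rho e -> x \notin F -> y \notin F \/ z \notin F ->
    deletable r rho x.
Proof.
move=> eN tr quad /andP[eF /existsP[C /andP[rC eC]]] xF yzF;
  rewrite /deletable xF /=.
suff [C' rC' xC'] : exists2 C', realizes r rho C' & x \notin C'.
  by apply/existsP; exists C'; rewrite rC'.
have [xC|xC] := boolP (x \in C); last by exists C.
have tr' : triangle r x z y by permute_triangle.
have eQ : [set x; z; y] = [set x; y; z] by rewrite -setUA (setUC [set z]) setUA.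
have quad' u : u \in [set x; z; y] ->
    s ((e |: [set x; z; y]) :\ u) = s (e |: [set x; z; y])
      by rewrite eQ; apply: quad.
have [yC|yC] := boolP (y \in C);
  first exact: (quad_drop_contracted tr rC xC yC).
have [zC|zC] := boolP (z \in C);
  first exact: (quad_drop_contracted tr' rC xC zC).
have [yF|yF] := boolP (y \in F).
  apply: (quad_exchange tr rC xC quad yF yC).
  have zF : z \notin F by case: yzF => //; rewrite yF.
  by clear -eF eC zF zC; set_solve.
have [zF|zF] := boolP (z \in F).
  by apply: (quad_exchange tr' rC xC quad' zF zC);
    clear -eF eC yF yC; set_solve.
by apply: (quad_drop_free rC quad xF); clear -eF eC yF yC zF zC; set_solve.
Qed.

Lemma realized_minor_moves :
  minor_moves F r s (deletable r rho) (contractible r rho).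
Proof.
split.
- move=> x xF; have [C rC] := realized_ex N; rewrite /deletable xF /=.
  have [xC|xC] := boolP (x \in C); apply/orP; [right|left];
    apply/existsP; exists C.
    by rewrite rC.
  by rewrite rC.
- exact: realized_triad_con.
- exact: realized_quad_del.
- exact: realized_undeletable_rank.
- exact: realized_coclosure_con.
Qed.

End Moves.

Lemma realized_minor_dual_moves r s rho : realized_minor r s rho ->
  minor_moves F s r (contractible r rho) (deletable r rho).
Proof.
move=> N; have [or triad quad undeletable coclosure] :=
  realized_minor_moves (realized_minorC N).
have eqd := deletable_dual N; have eqc := contractible_dual N.
split.
- by move=> x /or; rewrite eqd eqc.
- by move=> e a b td; rewrite -eqd -eqc; apply: (triad _ _ _ td).
- by move=> e x y z; rewrite -!eqd; apply: quad.
- by move=> A AF undel; apply: undeletable => // x /undel; rewrite eqd.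
- by move=> a A aA AF cl; have [x xA cx] := coclosure _ _ aA AF cl; exists x;
    rewrite -?eqc.
Qed.

End Realizers.

(** * Tangles *)

Section Tangles.
Variable T : finType.
Implicit Types (e : T) (A B C F P X Y Z : {set T}) (lam r s : {set T} -> nat).

Record tangle lam theta (Tg : {set {set T}}) : Prop := {
  tangle_conn : forall X, X \in Tg -> lam X < theta;
  tangle_or_setC : forall X, lam X < theta -> X \in Tg \/ ~: X \in Tg;
  tangle_cover : forall X Y Z, X \in Tg -> Y \in Tg -> Z \in Tg ->
    X :|: Y :|: Z <> setT;
  tangle_setC1 : forall e, ~: [set e] \notin Tg
}.

(* In the tangle matroid, [F] has rank [t], [X] is independent over [F], and [P]
   is the closure of [F]. *)
Definition tangle_rank_eq lam (Tg : {set {set T}}) F t :=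
  (exists Y, [/\ Y \in Tg, F \subset Y & lam Y <= t]) /\
  (forall Y, Y \in Tg -> F \subset Y -> t <= lam Y).

Definition independent_over lam (Tg : {set {set T}}) F t X :=
  forall Y, Y \in Tg -> F :|: X \subset Y -> t + #|X| <= lam Y.

Definition tangle_closure lam (Tg : {set {set T}}) F t P :=
  [/\ F \subset P, P \in Tg, lam P <= t &
      forall g, g \notin P -> independent_over lam Tg F t [set g]].

Variables (lam r s : {set T} -> nat) (theta : nat) (Tg : {set {set T}}).
Hypothesis M : dual_ranks lam r s.
Hypothesis tg : tangle lam theta Tg.

Lemma tangleS X Y : Y \in Tg -> X \subset Y -> lam X < theta -> X \in Tg.
Proof.
move=> YT XY lX; case: (tangle_or_setC tg lX) => // XT.
by case: (tangle_cover tg YT YT XT); set_solve.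
Qed.

Lemma tangleU X Y : X \in Tg -> Y \in Tg -> lam (X :|: Y) < theta ->
  X :|: Y \in Tg.
Proof.
move=> XT YT l; case: (tangle_or_setC tg l) => // h.
by case: (tangle_cover tg XT YT h); set_solve.
Qed.

Lemma tangle_of_card X : #|X| < theta -> X \in Tg.
Proof.
have [n] := ubnP #|X|; elim: n X => // n IHn X; rewrite ltnS => cX cT.
have lX : lam X < theta by have := conn_le_card M X; rank_lia.
have [X0|[x xX]] := set_0Vmem X.
  case: (tangle_or_setC tg lX) => //; rewrite X0 setC0 => ET.
  by case: (tangle_cover tg ET ET ET); rewrite !setUid.
have cx := cardsD1 x X; rewrite xX in cx.
have XT : X :\ x \in Tg by apply: IHn; rank_lia.
rewrite -(setD1K xX); apply: tangleU => //; last by rewrite setD1K.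
have : lam [set x] < theta
  by have := conn_le_card M [set x]; rewrite cards1; rank_lia.
by case/(tangle_or_setC tg) => //; rewrite (negbTE (tangle_setC1 tg x)).
Qed.

Lemma tangle_card_setCU X Y : X \in Tg -> Y \in Tg -> theta <= #|~: (X :|: Y)|.
Proof.
move=> XT YT; rewrite leqNgt; apply/negP=> /tangle_of_card ZT.
by case: (tangle_cover tg XT YT ZT); set_solve.
Qed.

Lemma tangle_card_setC X : X \in Tg -> theta <= #|~: X|.
Proof. by move=> XT; have := tangle_card_setCU XT XT; rewrite setUid. Qed.

Section OverF.
Variables (F : {set T}) (t : nat).
Hypothesis Ft : tangle_rank_eq lam Tg F t.

Lemma independent_over0 : independent_over lam Tg F t set0.
Proof. by move=> Y YT; rewrite setU0 cards0 addn0; apply: Ft.2. Qed.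

Lemma independent_over_disjoint X : t + #|X| <= theta ->
  independent_over lam Tg F t X -> X \subset ~: F.
Proof.
move=> cX indep; apply/subsetP=> x xX; rewrite inE; apply/negP=> xF.
have [[Y [YT FY lY]] _] := Ft; have cx := cardsD1 x X; rewrite xX in cx.
have XT : X :\ x \in Tg by apply: tangle_of_card; rank_lia.
have lU := connU_le M Y (X :\ x).
have UT : Y :|: (X :\ x) \in Tg by apply: tangleU => //; rank_lia.
have := indep _ UT; have -> : F :|: X \subset Y :|: (X :\ x).
  by clear -FY xF; set_solve.
by move=> /(_ isT); rank_lia.
Qed.

Lemma independent_overS X Y : t + #|X| <= theta -> Y \subset X ->
  independent_over lam Tg F t X -> independent_over lam Tg F t Y.
Proof.
move=> cX YX indep Z ZT FYZ; rewrite leqNgt; apply/negP=> lt.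
have cXY : #|X| = #|Y| + #|X :\: Y|.
  by have := cardsID Y X; rewrite (setIidPr YX).
have [Y0|Y0] := posnP #|Y|.
  have : F \subset Z by apply: subset_trans FYZ; apply: subsetUl.
  by move/(Ft.2 Z ZT); rank_lia.
have DT : X :\: Y \in Tg by apply: tangle_of_card; rank_lia.
have lU := connU_le M Z (X :\: Y).
have UT : Z :|: (X :\: Y) \in Tg by apply: tangleU => //; rank_lia.
have := indep _ UT; have -> : F :|: X \subset Z :|: (X :\: Y).
  by clear -FYZ; set_solve.
by move=> /(_ isT); rank_lia.
Qed.

Lemma independent_over_card X Y Z : t + #|X| <= theta ->
  independent_over lam Tg F t X -> Y \subset X -> Z \in Tg -> Y \subset Z ->
  #|Y| <= lam Z.
Proof.
move=> cX indep YX ZT YZ; rewrite leqNgt; apply/negP=> lt.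
have [[Y0 [Y0T FY0 lY0]] _] := Ft.
have cXY : #|X| = #|Y| + #|X :\: Y|.
  by have := cardsID Y X; rewrite (setIidPr YX).
have DT : X :\: Y \in Tg by apply: tangle_of_card; rank_lia.
have lYZ := conn_submod M Y0 Z; have lYZX := connU_le M (Y0 :|: Z) (X :\: Y).
have UT : Y0 :|: Z :|: (X :\: Y) \in Tg.
  by apply: tangleU => //; [apply: tangleU => // |]; rank_lia.
have := indep _ UT; have -> : F :|: X \subset Y0 :|: Z :|: (X :\: Y).
  by clear -FY0 YZ; set_solve.
by move=> /(_ isT); rank_lia.
Qed.

Lemma tangle_rank_eq_setU X : t + #|X| < theta ->
  independent_over lam Tg F t X -> tangle_rank_eq lam Tg (F :|: X) (t + #|X|).
Proof.
move=> cX indep; split=> //; have [[Y [YT FY lY]] _] := Ft.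
have lU := connU_le M Y X; exists (Y :|: X); split; [|exact: setSU|by rank_lia].
apply: tangleU => //; last by rank_lia.
by apply: tangle_of_card; rank_lia.
Qed.

Lemma independent_over_setU1 X g : g \notin X ->
  independent_over lam Tg (F :|: X) (t + #|X|) [set g] ->
  independent_over lam Tg F t (g |: X).
Proof.
move=> gX indep Y YT FgXY; have := indep Y YT.
by rewrite cards1 cardsU1 gX -setUA (setUC X) => /(_ FgXY); rank_lia.
Qed.

End OverF.

Lemma tangle_rank_eq_ex F m :
  (exists Y, [/\ Y \in Tg, F \subset Y & lam Y <= m]) ->
  exists2 t, t <= m & tangle_rank_eq lam Tg F t.
Proof.
case=> Y [YT FY lY]; pose above (Z : {set T}) := (Z \in Tg) && (F \subset Z).
have aboveY : above Y by apply/andP.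
case: (arg_minnP (P := above) lam aboveY) => Z /andP[ZT FZ] min.
exists (lam Z); first by apply: leq_trans lY; apply: min.
split=> [|X XT FX]; first by exists Z.
by apply: min; apply/andP.
Qed.

Section Closure.
Variables (F : {set T}) (t : nat).
Hypothesis Ft : tangle_rank_eq lam Tg F t.
Hypothesis t_lt : t < theta.

Lemma tangle_closure_ex : exists P, tangle_closure lam Tg F t P.
Proof.
pose spanned (P : {set T}) := [&& F \subset P, P \in Tg & lam P <= t].
have [[Y [YT FY lY]] min] := Ft.
have spannedY : spanned Y by apply/and3P; split.
have [P /maxsetP[/and3P[FP PT lP] maxP] _] := maxset_exists spannedY.
exists P; split=> // g gP Z ZT FgZ; rewrite cards1 addn1 ltnNge;
  apply/negP=> lZ.
have FZ : F \subset Z := subset_trans (subsetUl _ _) FgZ.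
have lI : t <= lam (Z :&: P).
  rewrite leqNgt; apply/negP=> lt.
  have IT : Z :&: P \in Tg by apply: (tangleS ZT (subsetIl _ _)); rank_lia.
  by have := min _ IT; rewrite subsetI FZ FP => /(_ isT); rank_lia.
have lU : lam (Z :|: P) <= t by have := conn_submod M Z P; rank_lia.
have spannedU : spanned (Z :|: P).
  apply/and3P; split=> //; first exact: subset_trans FZ (subsetUl _ _).
  by apply: tangleU => //; rank_lia.
case/negP: gP; rewrite -(maxP _ spannedU (subsetUr _ _)) inE (subsetP FgZ) //.
by rewrite !inE eqxx orbT.
Qed.

End Closure.

Lemma tangle_small_sets F t P : 2 < theta -> t < theta -> connected3 lam ->
  tangle_closure lam Tg F t P ->
  small_sets lam [pred A | (A \in Tg) && (lam A <= 2)] P.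
Proof.
move=> th tth c3 [FP PT lP indep]; split=> /=.
- by move=> A /andP[].
- move=> A lA; rewrite (conn_setC M) lA !andbT; apply/orP.
  by apply: (tangle_or_setC tg); apply: leq_ltn_trans th.
- by move=> A B C /andP[AT _] /andP[BT _] /andP[CT _]; apply: (tangle_cover tg).
- move=> A cA; rewrite (leq_trans (conn_le_card M A) cA) andbT.
  by apply: tangle_of_card; apply: leq_ltn_trans th.
move=> A x /andP[AT lA] xA xP; rewrite leqNgt; apply/negP=> c.
have cC : 1 < #|~: (A :&: P)|.
  apply: (@leq_trans #|~: A|); first by have := tangle_card_setC AT; rank_lia.
  by apply: subset_leq_card; set_solve.
have lI := c3 2 _ isT c cC; have sub := conn_submod M A P.
have UT : A :|: P \in Tg by apply: tangleU => //; rank_lia.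
have FxU : F :|: [set x] \subset A :|: P by clear -FP xA; set_solve.
by have := indep x xP _ UT FxU; rewrite cards1; rank_lia.
Qed.

End Tangles.

(** * Minors on their own ground set *)

Definition subground (T : finType) (E : {set T}) : finType := {x : T | x \in E}.

Definition elt (T : finType) (E : {set T}) (x : subground E) : T := sval x.

Local Notation lift A := [set elt x | x in A].

Section Subground.
Variables (T : finType) (E : {set T}).
Implicit Types (x : subground E) (A B C : {set subground E}) (F W Y : {set T}).

Definition restrict Y : {set subground E} := [set x | elt x \in Y].

Lemma elt_inj : injective (@elt _ E).
Proof. exact: val_inj. Qed.

Lemma eltP x : elt x \in E.
Proof. exact: valP. Qed.

Lemma elt_onto y : y \in E -> exists x : subground E, elt x = y.
Proof. by move=> yE; exists (exist _ y yE). Qed.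

Lemma mem_lift x A : (elt x \in lift A) = (x \in A).
Proof. exact: mem_imset elt_inj. Qed.

Lemma card_lift A : #|lift A| = #|A|.
Proof. exact: card_imset elt_inj. Qed.

Lemma lift_subset A : lift A \subset E.
Proof. by apply/subsetP=> y /imsetP[x _ ->]; apply: eltP. Qed.

Lemma liftI A B : lift (A :&: B) = lift A :&: lift B.
Proof. by apply: imsetI => x y _ _; apply: elt_inj. Qed.

Lemma lift_restrict Y : lift (restrict Y) = Y :&: E.
Proof.
apply/setP=> y; rewrite inE; apply/imsetP/andP=> [[x]|[yY yE]].
  by rewrite inE => xY ->; split=> //; apply: eltP.
by have [x e] := elt_onto yE; exists x; rewrite ?inE e.
Qed.

Lemma restrictK Y : Y \subset E -> lift (restrict Y) = Y.
Proof. by move=> YE; rewrite lift_restrict; apply/setIidPl. Qed.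

Lemma liftC A : lift (~: A) = E :\: lift A.
Proof.
apply/setP=> y; rewrite inE; apply/imsetP/andP=> [[x xA ->]|[yA yE]].
  by rewrite mem_lift -in_setC; split=> //; apply: eltP.
by have [x e] := elt_onto yE; exists x; rewrite // inE -mem_lift e.
Qed.

Lemma liftT : lift [set: subground E] = E.
Proof. by rewrite -setC0 liftC imset0 setD0. Qed.

Section MinorRank.
Variables (r : {set T} -> nat) (G : {set T}).
Hypothesis R : rank_function r.

Definition minor_rank A := r (lift A :|: G) - r G.

Lemma minor_rankE A : minor_rank A + r G = r (lift A :|: G).
Proof. by rewrite subnK //; apply: (rank_mono R); apply: subsetUr. Qed.

Lemma minor_rank_function : rank_function minor_rank.
Proof.
split=> [A|A B AB|A B].
- have := rankU R (lift A) G; have := rank_le_card R (lift A).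
  by rewrite card_lift -minor_rankE; rank_lia.
- have := rank_mono R (setSU G (imsetS (@elt _ E) AB)).
  by rewrite -!minor_rankE; rank_lia.
have := rank_submod R (lift A :|: G) (lift B :|: G).
by rewrite -setUIl -liftI -setUUl -imsetU -!minor_rankE; rank_lia.
Qed.

Lemma realizes_minor F rho C : F \subset E -> G \subset ~: F ->
  realizes (restrict F) minor_rank (fun A => rho (lift A)) C =
  realizes F r rho (lift C :|: G).
Proof.
move=> FE GF; have liftF := restrictK FE.
have subF (W : {set T}) : W \subset F -> lift (restrict W) = W.
  by move=> WF; apply: restrictK; apply: subset_trans FE.
apply/realizesP/realizesP=> -[CF rhoE]; split.
- rewrite subUset GF andbT; apply/subsetP=> y /imsetP[x xC ->].
  by have := subsetP CF x xC; rewrite !inE.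
- move=> W WF; have sub : restrict W \subset restrict F.
    by apply/subsetP=> x; rewrite !inE; apply: (subsetP WF).
  have := rhoE _ sub; rewrite subF // setUA; have := minor_rankE C.
  by have := minor_rankE (restrict W :|: C); rewrite imsetU subF //; rank_lia.
- apply/subsetP=> x xC; rewrite !inE; have := subsetP CF (elt x).
  by rewrite !inE mem_lift xC => /(_ isT).
move=> A AF; have sub : lift A \subset F by rewrite -liftF; apply: imsetS.
have := rhoE _ sub; rewrite setUA -imsetU -!minor_rankE; rank_lia.
Qed.

End MinorRank.
End Subground.

Section Minor.
Variables (T : finType) (lam r s : {set T} -> nat) (D G : {set T}).
Hypothesis M : dual_ranks lam r s.
Hypothesis DG : D \subset ~: G.
Let R := primal_rank M.
Local Notation X := (D :|: G).
Local Notation E := (~: X).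
Local Notation rN := (@minor_rank T E r G).
Local Notation lamN := (connectivity rN).
Implicit Types A : {set subground E}.

Lemma minor_dual_ranks : dual_ranks lamN rN (corank rN).
Proof. by apply/dual_ranks_corank/minor_rank_function/R. Qed.

Lemma lift_setC_contract A : lift (~: A) :|: G = ~: (D :|: lift A).
Proof.
by rewrite liftC; have := lift_subset A; clear -DG => sub; set_solve.
Qed.

Lemma lift_setC_removed A : lift (~: A) = ~: (lift A :|: X).
Proof. by rewrite liftC; clear; set_solve. Qed.

Lemma minor_connE A :
  lamN A + r (~: D) + r G = r (lift A :|: G) + r (~: (D :|: lift A)).
Proof.
have := connE minor_dual_ranks A; have := minor_rankE G R A.
have := minor_rankE G R (~: A).
have := minor_rankE G R (~: (set0 : {set subground E})).
by rewrite !lift_setC_contract imset0 setU0 setC0; rank_lia.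
Qed.

Lemma conn_le_minor A : lam (lift A :|: X) <= lamN A + #|X|.
Proof.
have := connE M (lift A :|: X); have := minor_connE A.
have := rankU R (lift A :|: G) D; have := rank_le_card R D;
  have := rank_le_card R G.
have -> : (lift A :|: G) :|: D = lift A :|: X by clear; set_solve.
have : r (~: (lift A :|: X)) <= r (~: (D :|: lift A)).
  by apply: (rank_mono R); clear; set_solve.
have := rank_leT R (~: D); rewrite (card_setU_disjoint (B := G));
  last by clear -DG; set_solve.
by rank_lia.
Qed.

Lemma minor_conn_le A : lamN A <= lam (lift A :|: X).
Proof.
have sub := lift_subset A; have := connE M (lift A :|: X);
  have := minor_connE A.
have := rankU R (~: (lift A :|: X)) G.
have -> : ~: (lift A :|: X) :|: G = ~: (D :|: lift A).
  by rewrite -lift_setC_removed lift_setC_contract.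
have := rank_submod R (lift A :|: X) (~: D).
have -> : (lift A :|: X) :|: ~: D = setT by clear; set_solve.
have -> : (lift A :|: X) :&: ~: D = lift A :|: G by clear -sub DG; set_solve.
by rank_lia.
Qed.

Lemma minor_connected3_connected3 : minor_connected3 r D G -> connected3 lamN.
Proof.
move=> c3 k A k3 cA cAC; have := c3 k (lift A) k3 (lift_subset A).
rewrite card_lift (setUC _ (lift A)) -lift_setC_removed card_lift =>
  /(_ cA cAC).
by have := minor_connE A; rank_lia.
Qed.

Lemma minor_connected3_lift D' C' :
  minor_connected3 rN D' C' ->
  minor_connected3 r (D :|: lift D') (G :|: lift C').
Proof.
move=> c3 k Y k3 sub cY cYC.
have subE : Y \subset E by clear -sub; set_solve.
have eY := restrictK subE.
have subN : restrict E Y \subset ~: (D' :|: C').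
  apply/subsetP=> x; rewrite [x \in restrict _ _]inE => xY;
    have := subsetP sub _ xY.
  by rewrite !inE !mem_lift !negb_or => /andP[/andP[_ ->] /andP[_ ->]].
have := c3 k (restrict E Y) k3 subN.
rewrite -(card_lift (restrict _ _)) eY => /(_ cY).
have -> : #|~: (D' :|: C' :|: restrict E Y)| =
  #|~: (D :|: lift D' :|: (G :|: lift C') :|: Y)|.
  rewrite -card_lift lift_setC_removed !imsetU eY; congr #|pred_of_set _|.
  by clear; set_solve.
move/(_ cYC); have := minor_rankE G R C'; have := minor_rankE G R (~: D').
have := minor_rankE G R (restrict E Y :|: C').
have := minor_rankE G R (~: (D' :|: restrict E Y)).
rewrite !lift_setC_contract !imsetU eY (setUC G (lift C')) !setUA.
by rank_lia.
Qed.

Definition minor_tangle theta (Tg : {set {set T}}) : {set {set subground E}} :=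
  [set A : {set subground E} |
    (lift A :|: X \in Tg) && (lamN A < theta - #|X|)].

Lemma tangle_minor theta Tg : tangle lam theta Tg -> #|X| < theta ->
  tangle lamN (theta - #|X|) (minor_tangle theta Tg).
Proof.
move=> tg cX; have XT : X \in Tg := tangle_of_card M tg cX.
have small_conn A : lamN A < theta - #|X| -> lam (lift A :|: X) < theta.
  by have := conn_le_minor A; rank_lia.
split=> [A|A lA|A B C|e].
- by rewrite inE => /andP[].
- have lAC : lamN (~: A) = lamN A := conn_setC minor_dual_ranks A.
  case: (tangle_or_setC tg (small_conn _ lA)) => AT; [left|right];
    rewrite inE ?lAC lA andbT //.
  rewrite -lift_setC_removed in AT; apply: (tangleU tg AT XT).
  by apply: small_conn; rewrite lAC.
- rewrite !inE => /andP[AT _] /andP[BT _] /andP[CT _] eT.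
  apply: (tangle_cover tg AT BT CT); have /setP eE := liftT E; apply/setP=> u.
  by have := eE u; rewrite -eT !imsetU !inE; do !case: (u \in _).
rewrite inE; apply/negP=> /andP[eT _].
have := tangle_setC1 tg (elt e).
rewrite (_ : ~: [set elt e] = lift (~: [set e]) :|: X) ?eT //.
rewrite lift_setC_removed imset_set1; have := eltP e.
by rewrite !inE negb_or => /andP[eD eG]; clear -eD eG; set_solve.
Qed.

End Minor.

(** * Removing one more element *)

Section Removal.
Variables (T : finType) (lam r s : {set T} -> nat).
Variables (theta : nat) (Tg : {set {set T}}).
Variables (F : {set T}) (rho : {set T} -> nat) (t : nat).

Definition minor_survives (D G : {set T}) :=
  exists C, [/\ realizes F r rho C, G \subset C & D \subset ~: C].

Record removed (D G : {set T}) : Prop := {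
  removed_disjoint : D \subset ~: G;
  removed_connected3 : minor_connected3 r D G;
  removed_independent : independent_over lam Tg F t (D :|: G);
  removed_survives : minor_survives D G
}.

Hypothesis M : dual_ranks lam r s.
Hypothesis tg : tangle lam theta Tg.
Hypothesis loopless : forall x, x \in F -> 0 < rho [set x].
Hypothesis coloopless : forall x, x \in F -> rho F <= rho (F :\ x).
Hypothesis Ft : tangle_rank_eq lam Tg F t.
Let R := primal_rank M.

Section Step.
Variables D G : {set T}.
Hypothesis rmv : removed D G.
Local Notation X := (D :|: G).
Local Notation E := (~: X).
Local Notation rN := (@minor_rank T E r G).
Local Notation lamN := (connectivity rN).
Local Notation rhoN := (fun A : {set subground E} => rho (lift A)).
Local Notation smallN :=
  [pred A | (A \in minor_tangle r D G theta Tg) && (lamN A <= 2)].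
Hypothesis tX : t + 2 * #|X| < theta.
Hypothesis cX : #|X| + 3 <= theta.
Let DG : D \subset ~: G := removed_disjoint rmv.
Let MN := minor_dual_ranks D G M.
Let cX' : #|X| < theta. Proof. by rank_lia. Qed.
Let tgN := tangle_minor M DG tg cX'.
Let c3N : connected3 lamN :=
  minor_connected3_connected3 M DG (removed_connected3 rmv).
Let XF : X \subset ~: F.
Proof.
by apply: (independent_over_disjoint M tg Ft _ (removed_independent rmv));
  rank_lia.
Qed.
Let FE : F \subset E.
Proof. by move: XF; clear; rewrite !subsets_disjoint !setCK disjoint_sym. Qed.
Let GF : G \subset ~: F. Proof. exact: subset_trans (subsetUr _ _) XF. Qed.

Lemma minor_simple : simple_rank rN /\ simple_rank (corank rN).
Proof.
have large (A : {set subground E}) : #|A| <= 2 -> #|A| <= #|~: A|.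
  move=> cA; have : A \in minor_tangle r D G theta Tg.
    by apply: (tangle_of_card MN tgN); rank_lia.
  by move/(tangle_card_setC MN tgN); rank_lia.
split=> A cA; first by apply: (connected3_rank MN c3N) => //; apply: large.
by apply: (connected3_rank (dual_ranksC MN) c3N) => //; apply: large.
Qed.

Lemma minor_realized : realized_minor (restrict E F) lamN rN (corank rN) rhoN.
Proof.
have [simple cosimple] := minor_simple.
have eltF x : (x \in restrict E F) = (elt x \in F) by rewrite inE.
split=> // [x|x|].
- by rewrite eltF imset_set1; apply: loopless.
- rewrite eltF restrictK // setDE liftI liftC restrictK // imset_set1 => xF.
  have -> : F :&: (E :\: [set elt x]) = F :\ elt x; last exact: coloopless.
  by move: FE; clear => FE; set_solve.
have [C [rC GC DC]] := removed_survives rmv; exists (restrict E C).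
rewrite (realizes_minor R) //.
have -> // : lift (restrict E C) :|: G = C.
by rewrite lift_restrict; clear -GC DC; set_solve.
Qed.

Lemma minor_closure_ex : exists P : {set subground E},
  [/\ restrict E F \subset P, small_sets lamN smallN P, exists e, e \notin P &
      forall g, g \notin P ->
        independent_over lam Tg (F :|: X) (t + #|X|) [set elt g]].
Proof.
have tX' : t + #|X| < theta by rank_lia.
have FXt := tangle_rank_eq_setU M tg Ft tX' (removed_independent rmv).
have [Y [FXY YT lY indepY]] := tangle_closure_ex M tg FXt tX'.
have XY : X \subset Y := subset_trans (subsetUr _ _) FXY.
have liftY : lift (restrict E Y) :|: X = Y.
  by rewrite lift_restrict; clear -XY; set_solve.
have [|t' t't Yt'] := @tangle_rank_eq_ex _ lamN (minor_tangle r D G theta Tg)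
                       (restrict E Y) (t + #|X|).
  exists (restrict E Y); rewrite subxx inE liftY YT /=.
  by have := minor_conn_le M DG (restrict E Y);
    rewrite liftY => l; split=> //; rank_lia.
have t'_lt : t' < theta - #|X| by rank_lia.
have [P closP] := tangle_closure_ex MN tgN Yt' t'_lt; have [YP PT _ _] := closP.
exists P; split.
- apply: subset_trans YP; apply/subsetP=> x; rewrite !inE => xF.
  by apply: (subsetP FXY); rewrite inE xF.
- by apply: (tangle_small_sets MN tgN _ t'_lt c3N closP); rank_lia.
- have : 0 < #|~: P| by have := tangle_card_setC MN tgN PT; rank_lia.
  by case/card_gt0P=> e; rewrite inE; exists e.
move=> g gP; apply: indepY; apply: contraNN gP => gY.
by apply: (subsetP YP); rewrite inE.
Qed.

Lemma realizes_removed C : realizes (restrict E F) rN rhoN C ->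
  [/\ realizes F r rho (lift C :|: G), G \subset lift C :|: G &
    D \subset ~: (lift C :|: G)].
Proof.
rewrite (realizes_minor R) // => rC; split=> //; first exact: subsetUr.
by have := lift_subset C; clear -DG => sub; set_solve.
Qed.

Lemma removal_step :
  exists2 g, g \notin X & removed (g |: D) G \/ removed D (g |: G).
Proof.
have N := minor_realized; have [P [FP smalls [e eP] indep]] := minor_closure_ex.
have ctx : removal_context lamN smallN P (restrict E F) rN (corank rN)
           (deletable (restrict E F) rN rhoN)
           (contractible (restrict E F) rN rhoN).
  by split=> //; [apply: realized_minor_moves N |
    apply: realized_minor_dual_moves N].
have [f fP good] := unobstructed_removal ctx eP; exists (elt f).
  by have := eltP f; rewrite inE.
have := eltP f; rewrite !inE negb_or => /andP[fD fG].
have indepX : independent_over lam Tg F t (elt f |: X).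
  apply: independent_over_setU1 (indep f fP).
  by rewrite inE negb_or fD.
case/orP: good => /andP[]; [case/andP=> _ /existsP[C /andP[rC fC]] nob|].
  left; split.
  - by rewrite subUset sub1set inE fG.
  - have := minor_connected3_lift M DG (unobstructed_deletion ctx nob).
    by rewrite imset_set1 imset0 setU0 setUC.
  - by rewrite -setUA.
  have [rC' GC DC] := realizes_removed rC; exists (lift C :|: G); split=> //.
  by rewrite subUset sub1set DC !inE mem_lift negb_or fC fG.
move=> /existsP[C /andP[rC fC]] nob; right; split.
- by clear -DG fD; set_solve.
- have cN := unobstructed_deletion (removal_contextC ctx) nob.
  have disj : [set f] \subset ~: set0 by rewrite setC0 subsetT.
  have c3f := minor_connected3_dual (dual_ranksC MN) disj cN.
  have := minor_connected3_lift M DG c3f.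
  by rewrite imset_set1 imset0 setU0 (setUC G).
- by rewrite setUCA.
have [rC' GC DC] := realizes_removed rC; exists (lift C :|: G); split=> //.
by rewrite subUset GC sub1set inE mem_lift fC.
Qed.

End Step.
End Removal.

(** * Sparse sets in a forest *)

Section Forest.
Variables (T : finType) (X : {set T}) (time : T -> nat)
  (parent : T -> option T).
Implicit Types (c u v z : T) (K : {set T}) (depth : T -> nat).
Hypothesis parent_later : forall v u, v \in X -> parent v = Some u ->
  u \in X /\ time v < time u.

Definition spares K := forall z u, z \in X -> parent z = Some u -> u \in K ->
  exists2 c, c \in X & parent c = Some z /\ c \notin K.

Definition leaves := [set v in X | [forall c in X, parent c != Some v]].

Definition upper :=
  [set v in X | (v \notin leaves) && [forall c in leaves, parent c != Some v]].

Lemma depth_ex : exists depth, forall v u, v \in X -> parent v = Some u ->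
  depth v = (depth u).+1.
Proof.
pose bound := (\max_(v in X) time v).+1.
have time_lt v : v \in X -> time v < bound.
  by move=> vX; rewrite ltnS; apply: (leq_bigmax_cond (F := time)).
suff [depth dE] : exists depth, forall v, v \in X ->
    depth v = if parent v is Some u then (depth u).+1 else 0.
  by exists depth => v u vX e; rewrite dE // e.
have [n] : exists n, forall v, v \in X -> bound - time v <= n.
  by exists bound => v _; apply: leq_subr.
suff bounded_ex m : exists depth, forall v, v \in X -> bound - time v <= m ->
    depth v = if parent v is Some u then (depth u).+1 else 0.
  by move=> le_n; have [depth dE] := bounded_ex n; exists depth => v vX;
    apply: dE => //; apply: le_n.
elim: m => [|m [depth dE]].
  by exists (fun=> 0) => v vX; have := time_lt v vX; lia.
exists (fun v => if parent v is Some u then (depth u).+1 else 0) => v vX le_m.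
case e : (parent v) => [u|] //; have [uX lt] := parent_later vX e.
by rewrite dE //; have := time_lt u uX; lia.
Qed.

Lemma spares_leaves K : K \subset leaves -> spares K.
Proof.
move=> KL z u zX e /(subsetP KL); rewrite inE => /andP[_ /forall_inP/(_ z zX)].
by rewrite e eqxx.
Qed.

Lemma child_of_not_leaf z : z \in X -> z \notin leaves ->
  exists2 c, c \in X & parent c = Some z.
Proof.
move=> zX; rewrite inE zX negb_forall => /existsP[c].
by rewrite negb_imply negbK => /andP[cX /eqP]; exists c.
Qed.

(* Two steps up the forest change the parity of [depth ./2]. *)
Lemma spares_upper depth (b : bool) K :
  (forall v u, v \in X -> parent v = Some u -> depth v = (depth u).+1) ->
  K \subset [set v in upper | odd (depth v)./2 == b] -> spares K.
Proof.
move=> dE KU z u zX ez uK; have := subsetP KU u uK;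
  rewrite !inE => /andP[/and3P[_ _ up] /eqP du].
have zL : z \notin leaves.
  by apply/negP=> zL; move/forall_inP: up => /(_ z zL); rewrite ez eqxx.
have [c cX ec] := child_of_not_leaf zX zL; exists c => //; split=> //.
apply/negP=> /(subsetP KU); rewrite inE => /andP[_ /eqP].
by rewrite (dE c z) // (dE z u) //= du; case: b {KU du}.
Qed.

Lemma card_le_upper_leaves : #|X| <= #|upper| + 2 * #|leaves|.
Proof.
pose next c := odflt c (parent c).
have sub : X \subset upper :|: (leaves :|: next @: leaves).
  apply/subsetP=> v vX; rewrite !in_setU; have [vL|vL] := boolP (v \in leaves).
    by rewrite orbT.
  have [vN|vN] := boolP (v \in next @: leaves); first by rewrite !orbT.
  rewrite !orbF inE vX vL; apply/forall_inP=> c cL;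
    apply: contraNN vN => /eqP e.
  by apply/imsetP; exists c; rewrite // /next e.
have := subset_leq_card sub; have := cardsUI upper (leaves :|: next @: leaves).
by have := cardsUI leaves (next @: leaves);
  have := leq_imset_card next leaves; lia.
Qed.

Lemma subset_one_side (A D G : {set T}) k : A \subset D :|: G ->
  2 * k <= #|A| + 1 ->
  exists K, [/\ K \subset A, #|K| = k & K \subset D \/ K \subset G].
Proof.
move=> ADG cA; have cU : #|A| <= #|A :&: D| + #|A :&: G|.
  have := cardsUI (A :&: D) (A :&: G); rewrite -setIUr (setIidPl ADG); lia.
have [cD|cD] := leqP k #|A :&: D|.
  have [K KA cK] := subset_of_card cD; exists K; move: KA.
  by rewrite subsetI => /andP[KA KD]; split; auto.
have [K KA cK] : exists2 K : {set T}, K \subset A :&: G & #|K| = k.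
  by apply: subset_of_card; lia.
by exists K; move: KA; rewrite subsetI => /andP[KA KG]; split; auto.
Qed.

Lemma spares_ex k D G : 0 < k -> X \subset D :|: G -> 10 * k <= #|X| + 6 ->
  exists K, [/\ #|K| = k, spares K & K \subset D \/ K \subset G].
Proof.
move=> k0 XDG cX; have [depth dE] := depth_ex.
pose side b := [set v in upper | odd (depth v)./2 == b].
have sideX b : side b \subset X
  by apply/subsetP=> v; rewrite !inE => /andP[/andP[]].
have leavesX : leaves \subset X by apply/subsetP=> v; rewrite inE => /andP[].
have cU : #|upper| = #|side true| + #|side false|.
  rewrite -card_setU_disjoint.
    congr #|pred_of_set _|; apply/setP=> v.
    by rewrite in_setU !inE -andb_orr; case: (odd _); rewrite andbT.
  by apply/setP=> v; rewrite in_setI !inE; case: (odd _); rewrite ?andbF.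
have [cL|cL] := leqP (2 * k) (#|leaves| + 1).
  have [K [KL cK KDG]] := subset_one_side (subset_trans leavesX XDG) cL.
  by exists K; split=> //; apply: spares_leaves.
have [b cb] : exists b, 2 * k <= #|side b| + 1.
  have := card_le_upper_leaves; case: (leqP (2 * k) (#|side true| + 1)) => c h.
    by exists true.
  by exists false; lia.
have [K [KS cK KDG]] := subset_one_side (subset_trans (sideX b) XDG) cb.
by exists K; split=> //; apply: (spares_upper dE KS).
Qed.

End Forest.

(** * Undoing removals of one kind *)

Section Conflicts.
Variables (T : finType) (lam : {set T} -> nat).
Variables (theta : nat) (Tg : {set {set T}}).
Implicit Types (D G K Y Z : {set T}) (c d u v w x y z : T)
  (r s : {set T} -> nat).

(* [z] and [w] are in series in [M \ D], and ... *)
Definition series r D G z w :=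
  [&& z \in G, w \notin D :|: G & r (~: (D :|: [set z; w])) < r setT].

(* ... [d] lies in the cocircuit of [M] responsible for it. *)
Definition breaks r D z w d :=
  (d \in D) && (r (d |: ~: (D :|: [set z; w])) == r setT).

Definition conflict r D G z d :=
  [exists w, series r D G z w && breaks r D z w d].

Record removed_pair r s D G : Prop := {
  pair_ranks : dual_ranks lam r s;
  pair_tangle : tangle lam theta Tg;
  pair_disjoint : D \subset ~: G;
  pair_independent : forall Y Z, Y \subset D :|: G -> Z \in Tg -> Y \subset Z ->
    #|Y| <= lam Z;
  pair_connected3 : connected3 lam;
  pair_minor_connected3 : minor_connected3 r D G;
  pair_card : #|D :|: G| + 3 <= theta
}.

Lemma removed_pairC r s D G : removed_pair r s D G -> removed_pair s r G D.
Proof.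
case=> M tg DG indep c3 cN cX; rewrite setUC in indep cX; split=> //.
- exact: dual_ranksC.
- by clear -DG; set_solve.
exact: (minor_connected3_dual M DG).
Qed.

Section OneSide.
Variables (r s : {set T} -> nat) (D G : {set T}).
Hypothesis DGpair : removed_pair r s D G.
Let M := pair_ranks DGpair.
Let R := primal_rank M.
Let tg := pair_tangle DGpair.
Let DG := pair_disjoint DGpair.
Let cX := pair_card DGpair.
Let cN := pair_minor_connected3 DGpair.
Local Notation X := (D :|: G).
Let DX : D \subset X. Proof. exact: subsetUl. Qed.
Let GX : G \subset X. Proof. exact: subsetUr. Qed.
Let XT : X \in Tg. Proof. by apply: (tangle_of_card M tg); rank_lia. Qed.

Lemma removed_card_setC Z : #|Z| <= 2 -> theta <= #|~: (X :|: Z)|.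
Proof.
move=> cZ; apply: (tangle_card_setCU M tg XT).
by apply: (tangle_of_card M tg); rank_lia.
Qed.

Lemma card_setC_pair Z : #|Z| <= 2 -> 3 <= #|~: Z|.
Proof.
move=> cZ; have := removed_card_setC cZ.
by have := subset_leq_card (_ : ~: (X :|: Z) \subset ~: Z);
  rewrite setCS subsetUr => /(_ isT); rank_lia.
Qed.

Lemma removed_simple : simple_rank r.
Proof.
move=> Z cZ; apply: (connected3_rank M (pair_connected3 DGpair)) => //.
by have := card_setC_pair cZ; rank_lia.
Qed.

Lemma removed_rank Y : Y \subset X -> r Y = #|Y| /\ s Y = #|Y|.
Proof.
move=> YX; have c := subset_leq_card YX.
have YT : Y \in Tg by apply: (tangle_of_card M tg); rank_lia.
have := pair_independent DGpair YX YT (subxx _); have := rank_conn M Y.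
by have := rank_le_card R Y; have := rank_le_card (dual_rank M) Y; rank_lia.
Qed.

Lemma removed_rank_setC Y : Y \subset X -> r (~: Y) = r setT.
Proof.
by move=> YX; have := rank_dual M Y; rewrite (removed_rank YX).2; rank_lia.
Qed.

Lemma removed_rank_setC_outside Z : Z \subset ~: X -> #|Z| <= 2 ->
  r (~: (D :|: Z)) = r setT.
Proof.
move=> ZX cZ; have := rank_leT R (~: (D :|: Z)).
have [Z0|Z0] := posnP #|Z|.
  by move/eqP: Z0; rewrite cards_eq0 => /eqP->; rewrite setU0 removed_rank_setC.
have k3 : 0 < #|Z| < 3 by rewrite Z0.
have cC : #|Z| <= #|~: (X :|: Z)| by have := removed_card_setC cZ; rank_lia.
have := cN k3 ZX (leqnn _) cC; have := rankU R Z G; have := rank_le_card R Z.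
by rewrite (removed_rank_setC DX); rank_lia.
Qed.

Lemma series_uniq z w w' : series r D G z w -> series r D G z w' -> w = w'.
Proof.
case/and3P=> zG wX lw /and3P[_ w'X lw']; apply/eqP/negPn/negP=> ww'.
have wwX : [set w; w'] \subset ~: X by rewrite subUset !sub1set !in_setC wX.
have full : r (~: (D :|: [set w; w'])) = r setT.
  by apply: (removed_rank_setC_outside wwX); rewrite cards2; case: eqP.
have DzX : D :|: [set z] \subset X by rewrite subUset DX sub1set (subsetP GX).
have fullz := removed_rank_setC DzX.
have := rank_submod R (~: (D :|: [set z; w])) (~: (D :|: [set z; w'])).
have -> : ~: (D :|: [set z; w]) :|: ~: (D :|: [set z; w']) = ~: (D :|: [set z]).
  by clear -ww'; set_solve.
set I := _ :&: _; have := rankU1 R z I.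
have : r (~: (D :|: [set w; w'])) <= r (z |: I).
  by apply: (rank_mono R); rewrite /I; clear; set_solve.
by rank_lia.
Qed.

Lemma series_rank z w : series r D G z w ->
  r setT <= r (~: (D :|: [set z; w])) + 1.
Proof.
case/and3P=> zG _ _; have DzX : D :|: [set z] \subset X.
  by rewrite subUset DX sub1set (subsetP GX).
have := removed_rank_setC DzX; have := rankU1 R w (~: (D :|: [set z; w])).
have : r (~: (D :|: [set z])) <= r (w |: ~: (D :|: [set z; w])).
  by apply: (rank_mono R); clear; set_solve.
by rank_lia.
Qed.

Lemma series_disjoint z w : series r D G z w ->
  [/\ z != w, z \notin D, w \notin D & w \notin G].
Proof.
case/and3P=> zG; rewrite inE negb_or => /andP[wD wG] _; split=> //.
  by apply: contraNneq wG => <-.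
by apply/negP=> /(subsetP DG); rewrite inE zG.
Qed.

Lemma series_broken z w D' G' : series r D G z w -> D' \subset D ->
  G' \subset G ->
  z \notin G' -> minor_connected3 r D' G' ->
    exists2 d, breaks r D z w d & d \notin D'.
Proof.
move=> ser D'D G'G zG' cN'; have [zw zD wD wG] := series_disjoint ser.
have [_ _ lt] := and3P ser; have corank1 := series_rank ser.
set rest := ~: (D :|: [set z; w]) in lt corank1.
suff /existsP[d /andP[]] : [exists d, breaks r D z w d && (d \notin D')]
  by exists d.
apply: contraT => /existsPn unbroken.
have cl d : d \in D :\: D' -> r (d |: rest) = r rest.
  rewrite inE => /andP[dD' dD]; have := unbroken d;
    rewrite dD' andbT /breaks dD -/rest.
  by move/eqP; have := rankU1 R d rest; rank_lia.
have := rank_closureU R cl.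
have -> : (D :\: D') :|: rest = ~: (D' :|: [set z; w]).
  by rewrite /rest; clear -D'D zD wD; set_solve.
move=> rH0; have zwN : [set z; w] \subset ~: (D' :|: G').
  by clear -zD wD wG zG' D'D G'G; set_solve.
have czw : #|[set z; w]| = 2 by rewrite cards2 zw.
have cC : 2 <= #|~: (D' :|: G' :|: [set z; w])|.
  have sub : ~: (X :|: [set z; w]) \subset ~: (D' :|: G' :|: [set z; w]).
    by clear -D'D G'G; set_solve.
  have := removed_card_setC (Z := [set z; w]); rewrite czw => /(_ isT).
  by have := subset_leq_card sub; rank_lia.
have := cN' 2 _ isT zwN; rewrite czw rH0 => /(_ isT cC).
have := rankU R [set z; w] G'; have := rank_le_card R [set z; w].
by rewrite czw (removed_rank_setC (subset_trans D'D DX)); rank_lia.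
Qed.

Section Restored.
Variable K : {set T}.
Hypothesis KD : K \subset D.
Hypothesis broken : forall z w, series r D G z w ->
  exists2 d, breaks r D z w d & d \notin K.

Lemma restored_pair_rank z w : z \in X -> w \notin X ->
  r (~: (K :|: [set z; w])) = r setT.
Proof.
move=> zX wX; have mono (Z : {set T}) : Z \subset ~: (K :|: [set z; w]) ->
    r Z = r setT -> r (~: (K :|: [set z; w])) = r setT.
  by move/(rank_mono R); have := rank_leT R (~: (K :|: [set z; w])); rank_lia.
have wD : w \notin D by apply: contra wX; apply: (subsetP DX).
have [zD|zD] := boolP (z \in D).
  apply: (mono (~: (D :|: [set w]))).
    by clear -KD zD; set_solve.
  apply: removed_rank_setC_outside; rewrite ?cards1 //.
  by rewrite sub1set inE.
have zG : z \in G by move: zX; rewrite inE (negbTE zD).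
have := rank_leT R (~: (D :|: [set z; w]));
  rewrite leq_eqVlt => /orP[/eqP full|lt].
  by apply: (mono _ _ full); clear -KD; set_solve.
have [|d /andP[dD /eqP full] dK] := @broken z w; first by rewrite /series zG wX.
apply: (mono _ _ full).
have dz : d != z by apply: contraNneq zD => <-.
have dw : d != w by apply: contraNneq wD => <-.
by clear -KD dz dw dK; set_solve.
Qed.

Lemma restored_small_side k Z : 0 < k < 3 -> Z \subset ~: K -> k <= #|Z| ->
  #|Z :\: X| < k -> r setT + k <= r Z + r (~: (K :|: Z)).
Proof.
move=> /andP[k0 k3] ZK cZ cZX; rewrite leqNgt; apply/negP=> lt.
have cZK : #|Z :|: K| <= #|Z :\: X| + #|X|.
  have : Z :|: K \subset (Z :\: X) :|: X by clear -KD; set_solve.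
  by move/subset_leq_card; have := cardsUI (Z :\: X) X; rank_lia.
have ZKT : Z :|: K \in Tg by apply: (tangle_of_card M tg); rank_lia.
have indep : #|(Z :&: X) :|: K| <= lam (Z :|: K).
  apply: (pair_independent DGpair _ ZKT); last by clear; set_solve.
  by clear -KD; set_solve.
rewrite card_setU_disjoint in indep; last by clear -ZK; set_solve.
have lZK := connE M (Z :|: K); have uZK := rankU R Z K;
  have cK := rank_le_card R K.
rewrite (setUC Z K) in lZK uZK indep.
have cID := cardsID X Z.
have [cZX1 cZD1] : #|Z :&: X| = 1 /\ #|Z :\: X| = 1 by rank_lia.
have /cards1P[z ez] : #|Z :&: X| == 1 by rewrite cZX1.
have /cards1P[w ew] : #|Z :\: X| == 1 by rewrite cZD1.
have /setIP[zZ zX] : z \in Z :&: X by rewrite ez set11.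
have /setDP[wZ wX] : w \in Z :\: X by rewrite ew set11.
have eZ : Z = [set z; w] by rewrite -(setID Z X) ez ew.
have := restored_pair_rank zX wX; have := removed_simple (X := Z).
by rewrite -eZ -cID cZX1 cZD1; rank_lia.
Qed.

Lemma restored_connected3 : minor_connected3 r K set0.
Proof.
move=> k A k3; rewrite !setU0 (rank0 R) addn0 => AK cA cB.
have KX := subset_trans KD DX.
rewrite (removed_rank_setC KX).
have [cAX|cAX] := ltnP #|A :\: X| k; first exact: restored_small_side.
set B := ~: (K :|: A) in cB *.
have eBA : ~: (K :|: B) = A by rewrite /B; clear -AK; set_solve.
have [cBX|cBX] := ltnP #|B :\: X| k.
  have BK : B \subset ~: K by rewrite /B; clear; set_solve.
  by have := restored_small_side k3 BK cB cBX; rewrite eBA; rank_lia.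
have AX : A :\: X \subset ~: X by clear; set_solve.
have eBX : ~: (X :|: A :\: X) = B :\: X by rewrite /B; clear -KD; set_solve.
have := cN k3 AX cAX; rewrite eBX => /(_ cBX).
have -> : (A :\: X) :|: G = (A :\: D) :|: (G :&: B).
  by rewrite /B; clear -KD DG; set_solve.
have -> : ~: (D :|: A :\: X) = (B :\: D) :|: (G :&: A).
  by rewrite /B; clear -KD DG; set_solve.
have := rankU R (A :\: D) (G :&: B); have := rankU R (B :\: D) (G :&: A).
have := rank_le_card R (G :&: B); have := rank_le_card R (G :&: A).
have := rank_mono R (subsetDl A D); have := rank_mono R (subsetDl B D).
have : #|G| = #|G :&: A| + #|G :&: B|.
  rewrite -card_setU_disjoint /B; last by clear; set_solve.
  by congr #|pred_of_set _|; clear -KD DG; set_solve.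
by rewrite (removed_rank_setC DX) (removed_rank GX).1; rank_lia.
Qed.

End Restored.

Lemma series_corank z w : series r D G z w -> s (D :|: [set z; w]) <= #|D| + 1.
Proof.
move=> ser; have [zw zD wD _] := series_disjoint ser;
  have [_ _ lt] := and3P ser.
have := rank_dual M (D :|: [set z; w]); rewrite card_setU_disjoint.
  by rewrite cards2 zw; rank_lia.
by clear -zD wD; set_solve.
Qed.

End OneSide.

Lemma series_partner_neq r s D G z w x y : removed_pair r s D G ->
  series r D G z w -> series s G D x y -> y != w.
Proof.
move=> DGpair szw sxy; have DGpairC := removed_pairC DGpair;
  have M := pair_ranks DGpair.
have [R R'] := (primal_rank M, dual_rank M).
have sD := series_corank DGpair szw; have rG := series_corank DGpairC sxy.
have [zG wX _] := and3P szw; have [xD _ _] := and3P sxy.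
apply/negP=> /eqP yw; rewrite yw in rG.
have cU : #|w |: (D :|: G)| = #|D :|: G| + 1 by rewrite cardsU1 wX addnC.
have UT : w |: (D :|: G) \in Tg.
  by apply: (tangle_of_card M (pair_tangle DGpair));
    have := pair_card DGpair; rank_lia.
have := pair_independent DGpair (subxx _) UT (subsetUr _ _).
have := rank_conn M (w |: (D :|: G)).
have := rankU R (G :|: [set x; w]) (D :\ x); have := rank_le_card R (D :\ x).
have := rankU R' (D :|: [set z; w]) (G :\ z); have := rank_le_card R' (G :\ z).
have -> : (G :|: [set x; w]) :|: (D :\ x) = w |: (D :|: G)
  by clear -xD; set_solve.
have -> : (D :|: [set z; w]) :|: (G :\ z) = w |: (D :|: G)
  by clear -zG; set_solve.
have : #|D :|: G| = #|D| + #|G|.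
  by apply: card_setU_disjoint; have := pair_disjoint DGpair;
    clear => DG; set_solve.
by have := cardsD1 x D; have := cardsD1 z G; rewrite xD zG cU; rank_lia.
Qed.

(* Orthogonality: the circuit responsible for [x], [y] and the cocircuit
   responsible for [z], [w] cannot meet in [z] alone. *)
Lemma breaks_orthogonal r s D G z w x y : removed_pair r s D G ->
  series r D G z w -> series s G D x y -> breaks s G x y z -> breaks r D z w x.
Proof.
move=> DGpair szw sxy /andP[_ /eqP ez]; have DGpairC := removed_pairC DGpair;
  have M := pair_ranks DGpair.
have R := primal_rank M; have yw := series_partner_neq DGpair szw sxy.
have rG := series_corank DGpairC sxy.
have [_ zD _ wG] := series_disjoint DGpair szw;
  have [xy xG yG yD] := series_disjoint DGpairC sxy.
have [zG wX _] := and3P szw; have [xD _ _] := and3P sxy.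
rewrite /breaks xD; apply/eqP.
have zx : z != x by apply: contraNneq zD => ->.
have zy : z != y by apply: contraNneq yG => <-.
set V := (G :\ z) :|: [set x; y].
have eVC : ~: V = z |: ~: (G :|: [set x; y])
  by rewrite /V; clear -zx zy; set_solve.
have ezV : z |: V = G :|: [set x; y] by rewrite /V; clear -zG; set_solve.
have cV : #|V| = #|G| + 1.
  rewrite card_setU_disjoint; last by clear -xG yG; set_solve.
  by rewrite cards2 xy; have := cardsD1 z G; rewrite zG; rank_lia.
have rV : r (z |: V) = r V.
  have := rank_dual (dual_ranksC M) V; have := rankU1 R z V.
  by rewrite eVC ez ezV cV; rank_lia.
have VH : V \subset x |: ~: (D :|: [set z; w]).
  have DG := pair_disjoint DGpair; rewrite /V; clear -DG yD zy yw wG; set_solve.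
have := rank_closureS R VH rV.
have := rank_leT R (x |: ~: (D :|: [set z; w])).
have : r (~: (D :|: [set w])) <= r (z |: (x |: ~: (D :|: [set z; w]))).
  by apply: (rank_mono R); clear; set_solve.
suff -> : r (~: (D :|: [set w])) = r setT by rank_lia.
by apply: (removed_rank_setC_outside DGpair); rewrite ?cards1 // sub1set inE.
Qed.

End Conflicts.

Section RemovalOrder.
Variables (T : finType) (lam : {set T} -> nat) (theta : nat)
  (Tg : {set {set T}}).
Variable time : T -> nat.
Implicit Types (D G K : {set T}) (c d u v w x y z : T) (r s : {set T} -> nat).

(* [D'] and [G'] are the elements removed before [v]. *)
Definition removal_order r D G := forall v, v \in D :|: G -> exists D' G',
  [/\ D' \subset D, G' \subset G, v \notin D' :|: G', minor_connected3 r D' G' &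
      forall u, u \in D :|: G -> u \notin D' :|: G' -> u != v ->
        time v < time u].

Lemma removal_orderC r s D G : removed_pair lam theta Tg r s D G ->
  removal_order r D G -> removal_order s G D.
Proof.
move=> DGpair order v; rewrite setUC => /order[D' [G' [D'D G'G vN c3 later]]].
exists G', D'; rewrite (setUC G'); split=> //.
apply: (minor_connected3_dual (pair_ranks DGpair)) c3.
by have := pair_disjoint DGpair; clear -D'D G'G => DG; set_solve.
Qed.

Definition next r s D G v u :=
  (conflict r D G v u || conflict s G D v u) && (time v < time u).

Definition parent r s D G v := [pick u | next r s D G v u].

Lemma parentC r s D G : parent r s D G =1 parent s r G D.
Proof. by move=> v; apply: eq_pick => u; rewrite /next orbC. Qed.

Lemma conflict_mem r D G v u : conflict r D G v u -> v \in G /\ u \in D.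
Proof. by case/existsP=> w /andP[/and3P[vG _ _] /andP[uD _]]. Qed.

Section Side.
Variables (r s : {set T} -> nat) (D G : {set T}).
Hypothesis DGpair : removed_pair lam theta Tg r s D G.
Hypothesis order : removal_order r D G.
Let DG := pair_disjoint DGpair.

Lemma parent_spec v u : parent r s D G v = Some u -> next r s D G v u.
Proof. by rewrite /parent; case: pickP => // u' h [<-]. Qed.

Lemma parent_mem v u : parent r s D G v = Some u ->
  u \in D :|: G /\ time v < time u.
Proof.
case/parent_spec/andP=> /orP[]/conflict_mem[_ uX] lt; split=> //;
  by rewrite inE uX ?orbT.
Qed.

Lemma series_broken_later z w : series r D G z w ->
  exists2 d, breaks r D z w d & time z < time d.
Proof.
move=> ser; have [zG _ _] := and3P ser.
have [|D' [G' [D'D G'G zN c3 later]]] := order (v := z);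
  first by rewrite inE zG orbT.
have [zD' zG'] : z \notin D' /\ z \notin G'
  by move: zN; rewrite inE negb_or => /andP[].
have [d br dD'] := series_broken DGpair ser D'D G'G zG' c3.
have [dD _] := andP br;
  have dG : d \notin G by have := subsetP DG d dD; rewrite inE.
exists d => //; apply: later; first by rewrite inE dD.
  by rewrite inE negb_or dD' (contra (subsetP G'G d)).
by apply: contraNneq dG => ->.
Qed.

Lemma spares_connected3 K : K \subset D ->
  spares (D :|: G) (parent r s D G) K -> minor_connected3 r K set0.
Proof.
move=> KD sp; apply: (restored_connected3 DGpair KD) => z w ser.
have [zG _ _] := and3P ser; have [_ zD _ _] := series_disjoint DGpair ser.
have zX : z \in D :|: G by rewrite inE zG orbT.
have [d br lt] := series_broken_later ser.
have [u eu] : exists u, parent r s D G z = Some u.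
  rewrite /parent; case: pickP => [u _|no]; first by exists u.
  have /andP[] := negbT (no d); split=> //.
  by apply/orP; left; apply/existsP; exists w; rewrite ser.
have /andP[/orP[/existsP[w' /andP[ser' br']]|/conflict_mem[zD' _]] _] :=
  parent_spec eu;
  last by rewrite zD' in zD.
rewrite -(series_uniq DGpair ser ser') in br'; have [uK|uK] := boolP (u \in K);
  last by exists u.
have [c cX [ec cK]] := sp z u zX eu uK; exists c => //.
have /andP[/orP[/conflict_mem[_ zD']|/existsP[y /andP[sery bry]]] _] :=
  parent_spec ec.
  by rewrite zD' in zD.
exact: (breaks_orthogonal DGpair ser sery bry).
Qed.

End Side.

Lemma restorable_ex r s D G k : removed_pair lam theta Tg r s D G ->
  removal_order r D G -> 0 < k -> 10 * k <= #|D :|: G| + 6 ->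
  exists2 K : {set T}, #|K| = k &
    K \subset D /\ minor_connected3 r K set0 \/
    K \subset G /\ minor_connected3 r set0 K.
Proof.
move=> DGpair order k0 cX; have DGpairC := removed_pairC DGpair;
  have orderC := removal_orderC DGpair order.
have later v u (_ : v \in D :|: G) := @parent_mem r s D G v u.
have [K [cK sp KDG]] := spares_ex later k0 (subxx _) cX; exists K => //.
case: KDG => sub; [left|right]; split=> //;
  first exact: (spares_connected3 DGpair order sub sp).
apply: (minor_connected3_dual (pair_ranks DGpairC));
  first by rewrite setC0 subsetT.
apply: (spares_connected3 DGpairC orderC sub) => z u;
  rewrite setUC -parentC => zX ez uK.
by have [c cX' [ec cK']] := sp z u zX ez uK; exists c; rewrite // -parentC.
Qed.

End RemovalOrder.

Lemma removal_order_extend (T : finType) (r : {set T} -> nat) (time : T -> nat)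
    (D G D' G' : {set T}) g n :
  D' :|: G' = g |: (D :|: G) -> D \subset D' -> G \subset G' ->
    g \notin D :|: G ->
  minor_connected3 r D G -> (forall v, v \in D :|: G -> time v < n) ->
  removal_order time r D G ->
  removal_order (fun u => if u == g then n else time u) r D' G'.
Proof.
move=> eX DD' GG' gX c3 time_lt order v; rewrite eX => /setU1P[->|vX].
  exists D, G; split=> // u /setU1P[->|uX]; first by rewrite eqxx.
  by rewrite uX.
have vg : v != g by apply: contraNneq gX => <-.
have [Dv [Gv [DvD GvG vN c3v later]]] := order v vX; exists Dv, Gv; split=> //.
- exact: subset_trans DvD DD'.
- exact: subset_trans GvG GG'.
move=> u /setU1P[->|uX] uN uv; rewrite (negbTE vg) ?eqxx; first exact: time_lt.
by case: eqP => _; [apply: time_lt | apply: later].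
Qed.

Section Iteration.
Variables (T : finType) (lam r s : {set T} -> nat) (theta : nat)
  (Tg : {set {set T}}).
Variables (F : {set T}) (rho : {set T} -> nat) (t : nat).
Hypothesis M : dual_ranks lam r s.
Hypothesis tg : tangle lam theta Tg.
Hypothesis loopless : forall x, x \in F -> 0 < rho [set x].
Hypothesis coloopless : forall x, x \in F -> rho F <= rho (F :\ x).
Hypothesis Ft : tangle_rank_eq lam Tg F t.
Hypothesis c3 : connected3 lam.
Hypothesis survives : minor_survives r F rho set0 set0.

Lemma removal_sequence n : t + 2 * n <= theta + 1 -> n + 2 <= theta ->
  exists D G time, [/\ removed lam r Tg F rho t D G, #|D :|: G| = n,
    forall v, v \in D :|: G -> time v < n & removal_order time r D G].
Proof.
elim: n => [|n IHn] tn n2.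
  exists set0, set0, (fun=> 0); split=> [||v|v]; rewrite ?setU0 ?cards0 ?inE //.
  split=> //; first by rewrite sub0set.
    exact: minor_connected3_id M c3.
  by rewrite setU0; apply: independent_over0 Ft.
have [||D [G [time [rmv cX time_lt order]]]] := IHn; [rank_lia | rank_lia |].
have [||g gX rmv'] := removal_step M tg loopless coloopless Ft rmv; rewrite ?cX;
  try by rank_lia.
pose time' u := if u == g then n else time u.
have time'_lt v : v \in g |: (D :|: G) -> time' v < n.+1.
  move/setU1P=> [->|vX]; rewrite /time' ?eqxx //.
  by case: eqP => // _; apply/ltnW/time_lt.
have cX' : #|g |: (D :|: G)| = n.+1 by rewrite cardsU1 gX cX.
have extend D' G' : D' :|: G' = g |: (D :|: G) -> D \subset D' ->
  G \subset G' ->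
    removal_order time' r D' G'.
  move=> eX DD' GG'.
  exact: removal_order_extend eX DD' GG' gX (removed_connected3 rmv)
      time_lt order.
case: rmv' => rmv'.
  exists (g |: D), G, time'; rewrite -setUA; split=> //.
  by apply: extend => //; [rewrite setUA | apply: subsetUr].
exists D, (g |: G), time'; rewrite setUCA; split=> //.
by apply: extend => //; [apply: setUCA | apply: subsetUr].
Qed.

Lemma removable_set_ex k : 0 < k -> 20 * k + t <= theta + 13 ->
  exists K : {set T}, [/\ #|K| = k, independent_over lam Tg F t K &
    minor_connected3 r K set0 /\ minor_survives r F rho K set0 \/
    minor_connected3 r set0 K /\ minor_survives r F rho set0 K].
Proof.
move=> k0 kt.
have [||D [G [time [rmv cX _ order]]]] := @removal_sequence (10 * k - 6).
- by rank_lia.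
- by rank_lia.
have [DG cN indep [C [rC GC DC]]] := rmv.
have tX : t + #|D :|: G| <= theta by rank_lia.
have DGpair : removed_pair lam theta Tg r s D G.
  split=> //; last by rank_lia.
  by move=> Y Z; apply: (independent_over_card M tg Ft tX indep).
have [|K cK KDG] := restorable_ex DGpair order k0; first by rank_lia.
have indepK : K \subset D :|: G -> independent_over lam Tg F t K.
  by move=> KX; apply: (independent_overS M tg Ft tX KX indep).
exists K; case: KDG => -[sub c3K]; split=> //.
- by apply: indepK; apply: subset_trans sub (subsetUl _ _).
- left; split=> //; exists C; split; rewrite ?sub0set //.
  exact: subset_trans sub DC.
- by apply: indepK; apply: subset_trans sub (subsetUr _ _).
right; split=> //; exists C; split; rewrite ?sub0set //.
exact: subset_trans sub GC.
Qed.

End Iteration.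

(** * Matroids on a subset of the type *)

Section TangleRank.
Variables (T : finType) (M : matroid T) (theta : nat) (Tg : {set {set T}}).
Implicit Types X Y : {set T}.

Lemma tangle_rank_geP X n : n <= theta ->
  reflect (forall Y, Y \in Tg -> X \subset Y -> n <= lambda M Y)
          (n <= tangle_rank M theta Tg X).
Proof.
move=> nt; rewrite /tangle_rank; case: existsP => [_|no].
  rewrite -Order.NatOrder.minEnat -Order.NatOrder.leEnat.
  apply: (iffP (Order.TotalTheory.bigmin_geP _ _ _ _)).
    by case=> _ h Y YT XY; apply: h; rewrite YT.
  by move=> h; split=> // Y /andP[YT XY]; apply: h.
by rewrite nt; apply: ReflectT => Y YT XY; case: no; exists Y; rewrite YT.
Qed.

Lemma tangle_rank_leP X n : n < theta ->
  reflect (exists Y, [/\ Y \in Tg, X \subset Y & lambda M Y <= n])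
          (tangle_rank M theta Tg X <= n).
Proof.
move=> nt; apply: (iffP idP) => [|[Y [YT XY lY]]].
  rewrite leqNgt => /(tangle_rank_geP _ nt) no.
  have [/exists_inP[Y YT /andP[XY lY]]|/exists_inPn none] :=
    boolP [exists Y in Tg, (X \subset Y) && (lambda M Y <= n)];
      first by exists Y.
  by case: no => Y YT XY; have := none Y YT; rewrite XY -ltnNge.
rewrite leqNgt; apply/negP=> /(tangle_rank_geP _ nt)/(_ Y YT XY).
by rewrite ltnNge lY.
Qed.

End TangleRank.

Section GroundRank.
Variables (T : finType) (M : matroid T).
Hypothesis matM : is_matroid M.
Local Notation E := (ground M).
Implicit Types (A C K : {set subground E}) (W X Y : {set T}).

Definition ground_rank A := rk M (lift A).
Local Notation lamM := (connectivity ground_rank).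

Lemma ground_rank_function : rank_function ground_rank.
Proof.
case: matM => card mono submod; split=> [A|A B AB|A B]; rewrite /ground_rank.
- by rewrite -card_lift; apply/card/lift_subset.
- by apply: mono; [apply: imsetS | apply: lift_subset].
by rewrite imsetU liftI; apply: submod; apply: lift_subset.
Qed.

Lemma ground_conn A : lamM A = lambda M (lift A).
Proof. by rewrite /connectivity /lambda /ground_rank liftC liftT. Qed.

Definition ground_tangle (Tg : {set {set T}}) : {set {set subground E}} :=
  [set A : {set subground E} | lift A \in Tg].

Lemma ground_tangle_tangle theta Tg : is_tangle M theta Tg ->
  tangle lamM theta (ground_tangle Tg).
Proof.
case=> conn or_setC cover setC1; split=> [A|A|A B C|e]; rewrite ?inE.
- by rewrite ground_conn => /conn[].
- by rewrite ground_conn liftC; apply/or_setC/lift_subset.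
- move=> AT BT CT eT; apply: (cover _ _ _ AT BT CT).
  by rewrite -!imsetU eT liftT.
by rewrite liftC imset_set1; apply/setC1/eltP.
Qed.

Lemma ground_connected3 : three_connected M -> connected3 lamM.
Proof.
move=> c3 k A k3 cA cAC; rewrite ground_conn leqNgt; apply/negP=> lt.
by apply: (c3 k k3 (lift A)); split; rewrite -?liftC ?card_lift ?lift_subset.
Qed.

Lemma ground_tangle_rank theta Tg X t : is_tangle M theta Tg -> X \subset E ->
  t < theta -> tangle_rank M theta Tg X = t <->
  tangle_rank_eq lamM (ground_tangle Tg) (restrict E X) t.
Proof.
move=> [conn _ _ _] XE tt; have leP := tangle_rank_leP M Tg X tt.
have geP := tangle_rank_geP M Tg X (ltnW tt); split=> [eX|[[A [AT XA lA]] min]].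
  have [Y [YT XY lY]] := elimT leP (eq_leq eX); have [YE _] := conn Y YT.
  split=> [|A].
    exists (restrict E Y); rewrite inE ground_conn restrictK //; split=> //.
    by apply/subsetP=> x; rewrite !inE; apply: (subsetP XY).
  rewrite inE ground_conn => AT /(imsetS (@elt _ E));
    rewrite restrictK // => XA.
  by apply: (elimT geP _ _ AT XA); rewrite eX.
apply/eqP; rewrite eqn_leq; apply/andP; split.
  apply/leP; exists (lift A); rewrite -ground_conn; split=> //.
    by move: AT; rewrite inE.
  by rewrite -(restrictK XE); apply: imsetS.
apply/geP=> Y YT XY; have [YE _] := conn Y YT.
have := min (restrict E Y); rewrite inE ground_conn restrictK //; apply=> //.
by apply/subsetP=> x; rewrite !inE; apply: (subsetP XY).
Qed.

Lemma lift_outside K X : X \subset E :\: lift K -> exists A,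
  [/\ X = lift A, A \subset ~: K & (E :\: lift K) :\: X = lift (~: (K :|: A))].
Proof.
move=> XEK; have XE := subset_trans XEK (subsetDl _ _).
exists (restrict E X); rewrite liftC imsetU restrictK // setDDl; split=> //.
apply/subsetP=> x; have := subsetP XEK (elt x); rewrite !inE mem_lift => h xX.
by have /andP[] := h xX.
Qed.

Lemma delete_connected3 K : minor_connected3 ground_rank K set0 ->
  three_connected (delete M (lift K)).
Proof.
move=> c3 k k3 X [/= /lift_outside[A [-> AK eC]]];
  rewrite /lambda /= eC !card_lift.
move=> cA cAC; have := c3 k A k3; rewrite !setU0 (rank0 ground_rank_function).
move=> /(_ AK cA cAC); rewrite -liftC -!/(ground_rank _).
by case/andP: k3; rank_lia.
Qed.

Lemma contract_connected3 K : minor_connected3 ground_rank set0 K ->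
  three_connected (contract M (lift K)).
Proof.
move=> c3 k k3 X [/= /lift_outside[A [-> AK eC]]];
  rewrite /lambda /= eC !card_lift.
move=> cA cAC; have := c3 k A k3; rewrite !set0U setC0 => /(_ AK cA cAC).
have eCK : ~: (K :|: A) :|: K = ~: A by clear -AK; set_solve.
rewrite -(liftC K) -!imsetU (setUC (~: K)) setUCr eCK -!/(ground_rank _).
have mono := rank_mono ground_rank_function; have := mono _ _ (subsetUr A K).
have : ground_rank K <= ground_rank (~: A) by rewrite -eCK; apply/mono/subsetUr.
by have := mono _ _ (subsetT K); case/andP: k3; rank_lia.
Qed.

Section GroundMinor.
Variable N : matroid T.
Hypothesis NE : ground N \subset E.
Local Notation F := (restrict E (ground N)).
Local Notation rhoN := (fun A : {set subground E} => rk N (lift A)).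

Lemma ground_realizesP C : reflect
  (lift C \subset ~: ground N /\
   forall W, W \subset ground N -> rk N W + rk M (lift C) = rk M (W :|: lift C))
  (realizes F ground_rank rhoN C).
Proof.
apply: (iffP (realizesP _ _ _ _)) => -[CN rkE]; split.
- apply/subsetP=> y /imsetP[x xC ->]; rewrite inE.
  by have := subsetP CN x xC; rewrite !inE.
- move=> W WN; have WE := subset_trans WN NE.
  have := rkE (restrict E W); rewrite /ground_rank imsetU restrictK //; apply.
  by apply/subsetP=> x; rewrite !inE; apply: (subsetP WN).
- apply/subsetP=> x xC; have := subsetP CN (elt x).
  by rewrite mem_lift !inE => /(_ xC).
move=> A AF; rewrite /ground_rank imsetU; apply: rkE.
by rewrite -(restrictK NE); apply: imsetS.
Qed.

Lemma ground_loopless : no_loops N -> forall x, x \in F -> 0 < rhoN [set x].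
Proof.
move=> noloop x; rewrite inE imset_set1 lt0n => xN.
by apply/eqP=> e; apply: (noloop (elt x)).
Qed.

Lemma ground_coloopless : no_coloops N ->
  forall x, x \in F -> rhoN F <= rhoN (F :\ x).
Proof.
move=> nocoloop x; rewrite inE setDE liftI liftC restrictK // imset_set1 => xN.
rewrite leqNgt; apply/negP=> lt; apply: (nocoloop (elt x)); split=> //.
by have -> : ground N :\ elt x = ground N :&: (E :\ elt x)
  by clear -NE; set_solve.
Qed.

Lemma minor_survives_ground : has_minor M N ->
  minor_survives ground_rank F rhoN set0 set0.
Proof.
case=> C [D [CE _ _ [/= eN rkE]]]; exists (restrict E C);
  rewrite !sub0set; split=> //.
apply/ground_realizesP; rewrite restrictK //; split.
  by rewrite eN; clear; set_solve.
move=> W WN; rewrite rkE //= subnK //; case: matM => _ mono _;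
  apply: mono (subsetUr _ _) _.
by rewrite subUset CE (subset_trans WN NE).
Qed.

Lemma delete_minor K : K \subset ~: F ->
  minor_survives ground_rank F rhoN K set0 ->
  has_minor (delete M (lift K)) N.
Proof.
move=> KF [C [/ground_realizesP[CN rkE] _ KC]].
have CE := lift_subset C.
have KN : lift K \subset ~: ground N.
  apply/subsetP=> y /imsetP[x xK ->]; have := subsetP KF x xK.
  by rewrite !inE.
have KC' : lift K \subset ~: lift C.
  apply/subsetP=> y /imsetP[x xK ->]; have := subsetP KC x xK.
  by rewrite !inE mem_lift.
exists (lift C), (E :\: lift K :\: lift C :\: ground N); split=> /=.
- by clear -CE KC'; set_solve.
- by clear; set_solve.
- by rewrite disjoints_subset; clear; set_solve.
split=> /= [|W WN]; first by clear -NE CN KN; set_solve.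
by rewrite -rkE // addnK.
Qed.

Lemma contract_minor K : minor_survives ground_rank F rhoN set0 K ->
  has_minor (contract M (lift K)) N.
Proof.
case=> [C [/ground_realizesP[CN rkE] KC _]]; have CE := lift_subset C.
have KC' : lift K \subset lift C by apply: imsetS.
exists (lift C :\: lift K), (E :\: lift C :\: ground N); split=> /=.
- by clear -CE; set_solve.
- by clear -KC'; set_solve.
- by rewrite disjoints_subset; clear; set_solve.
split=> /= [|W WN]; first by clear -NE CN KC'; set_solve.
have -> : W :|: (lift C :\: lift K) :|: lift K = W :|: lift C
  by clear -KC'; set_solve.
have -> : lift C :\: lift K :|: lift K = lift C by clear -KC'; set_solve.
have KC_le : rk M (lift K) <= rk M (lift C) :=
  rank_mono ground_rank_function KC.
by rewrite -rkE // subnBA // subnK ?addnK // (leq_trans KC_le) ?leq_addl.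
Qed.

Lemma ground_removable_set_ex theta Tg k : three_connected M ->
  is_tangle M theta Tg -> has_minor M N -> no_loops N -> no_coloops N ->
  20 * k + tangle_rank M theta Tg (ground N) <= theta + 13 ->
  exists K, [/\ #|K| = k, K \subset ~: F,
    tangle_rank M theta Tg (ground N :|: lift K) =
      tangle_rank M theta Tg (ground N) + k &
    minor_connected3 ground_rank K set0 /\
      minor_survives ground_rank F rhoN K set0 \/
    minor_connected3 ground_rank set0 K /\
      minor_survives ground_rank F rhoN set0 K].
Proof.
set t := tangle_rank M theta Tg _.
move=> c3 tgM /minor_survives_ground survives noloop nocoloop kt.
have D := dual_ranks_corank ground_rank_function;
  have c3' := ground_connected3 c3.
have [k0|k_gt0] := posnP k.
  exists set0; rewrite k0 cards0 sub0set imset0 setU0 addn0; split=> //; left.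
  by split=> //; apply: (minor_connected3_id D).
have tt : t < theta by lia.
have tg := ground_tangle_tangle tgM;
  have Ft := (ground_tangle_rank tgM NE tt).1 erefl.
have [K [cK indep good]] := removable_set_ex D tg (ground_loopless noloop)
  (ground_coloopless nocoloop) Ft c3' survives k_gt0 kt.
have tK : t + #|K| < theta by lia.
have NKE : ground N :|: lift K \subset E by rewrite subUset NE lift_subset.
have FKt := tangle_rank_eq_setU D tg Ft tK indep.
exists K; split=> //.
  by apply: (independent_over_disjoint D tg Ft _ indep); apply: ltnW.
rewrite -cK; apply/(ground_tangle_rank tgM NKE tK).
by have -> : restrict E (ground N :|: lift K) = F :|: K
  by apply/setP=> x; rewrite !inE mem_lift.
Qed.

End GroundMinor.
End GroundRank.

Unset Implicit Arguments.

Theorem theorem5p3 (T : finType) (k : nat) (M N : matroid T) (theta : nat)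
    (Tg : {set {set T}}) :
  is_matroid M -> three_connected M -> is_tangle M theta Tg ->
  has_minor M N -> no_loops N -> no_coloops N ->
  let t := tangle_rank M theta Tg (ground N) in
  20 * k + t <= theta + 13 ->
  exists X : {set T},
    [/\ X \subset ground M, #|X| = k,
        tangle_rank M theta Tg (ground N :|: X) = t + k &
        (three_connected (delete M X) /\ has_minor (delete M X) N) \/
        (three_connected (contract M X) /\ has_minor (contract M X) N)].
Proof.
move=> matM c3 tgM mN noloop nocoloop t kt.
have NE : ground N \subset ground M.
  by case: mN => C [D [_ _ _ [/= -> _]]]; clear; set_solve.
have [K [cK KF rK good]] :=
  ground_removable_set_ex matM NE c3 tgM mN noloop nocoloop kt.
exists (lift K); rewrite lift_subset card_lift; split=> //.
case: good => -[c3K survK]; [left|right]; split.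
- exact: (delete_connected3 matM).
- exact: delete_minor survK.
- exact: (contract_connected3 matM).
exact: (contract_minor matM).
Qed.
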